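(* Let $M$ be a $C^{1,1}$-manifold of dimension $n>1$ and let $\nabla$ be a measurable torsion-free connection on $TM$. Then $\nabla$ is tame if and only if in any coordinate neighborhood, each $\Gamma^i_{\ jk}$ is locally integrable and each (i.e. for all $k,l$) $$\sum_{i,j}\left(\Gamma^i_{\ kl}\Gamma^j_{\ ji}-\Gamma^j_{\ ki}\Gamma^i_{\ lj}\right)$$ is locally integrable.
   Context: A $C^{1,1}$-manifold is a manifold with a (maximal) atlas whose transition maps have Lipschitz first derivatives. $\mathcal{D}^c$ is the line bundle of $c$-densities, associated to the frame bundle via $A\mapsto|\det A|^{-c}$; the product of two half-densities is a density, and compactly supported densities can be integrated. A measurable torsion-free connection is an $\mathbb{R}$-bilinear map $\nabla$ from pairs of Lipschitz vector fields to measurable vector fields with $\nabla_{fX}Y=f\nabla_XY$, $\nabla_X(fY)=(Xf)Y+f\nabla_XY$ and $\nabla_XY-\nabla_YX=[X,Y]$ for Lipschitz functions $f$ and Lipschitz vector fields $X,Y$. Its Christoffel symbols are given by $\nabla_{\partial_i}\partial_j=\sum_k\Gamma^k_{\ ji}\partial_k$ and are measurable. A Lipschitz vector-valued half-density is a Lipschitz section of $TM\otimes\mathcal{D}^{1/2}$; locally $V=\sum_jv^j\partial_j\otimes\sqrt{dx^1\cdots dx^n}$, and $\nabla_iV^j=(\nabla_iv^j)\sqrt{dx^1\cdots dx^n}$ with $$\nabla_iv^j=\partial_iv^j+\sum_k\Gamma^j_{\ ki}v^k-\tfrac12\sum_k\Gamma^k_{\ ki}v^j.$$ For compactly supported Lipschitz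 vector-valued half-densities $V,W$, put $$Q(V,W)=\int_M\sum_{i,j}\big[(\nabla_iV^i)(\nabla_jW^j)-(\nabla_iV^j)(\nabla_jW^i)\big].$$ $\nabla$ is tame if the integrand (a density on $M$) is integrable for all such $V$ and $W$. *)

(* Defs.v *)
From HB Require Import structures.
From mathcomp Require Import all_boot all_order all_algebra.
From mathcomp Require Import all_classical all_reals all_analysis.
From mathcomp Require Import measurable_realfun.

Set Implicit Arguments.
Unset Strict Implicit.
Unset Printing Implicit Defensive.

Import Order.TTheory GRing.Theory Num.Theory.
Import numFieldNormedType.Exports.

Local Open Scope classical_set_scope.
Local Open Scope ring_scope.

Notation Rn R n := (g_sigma_algebraType (@open 'rV[R]_n)).

Section lebesgue_Rn.
Context {R : realType}.

Definition Rn_cons n (z : measurableTypeR R * Rn R n) : Rn R n.+1 :=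
  row_mx (z.1%:M : 'rV[R]_1) (z.2 : 'rV[R]_n).

Definition Rn_uncons n (x : Rn R n.+1) : measurableTypeR R * Rn R n :=
  (lsubmx (x : 'rV[R]_(1 + n)) ord0 ord0, rsubmx (x : 'rV[R]_(1 + n))).

Lemma Rn_consK n : cancel (@Rn_cons n) (@Rn_uncons n).
Proof.
by move=> [a v]; rewrite /Rn_uncons /Rn_cons row_mxKl row_mxKr /= mxE eqxx.
Qed.

Lemma Rn_unconsK n : cancel (@Rn_uncons n) (@Rn_cons n).
Proof.
move=> x; rewrite /Rn_uncons /Rn_cons /= -[RHS](@hsubmxK _ 1 1 n).
rewrite [X in row_mx X _](_ : _ = lsubmx (x : 'rV[R]_(1 + n))) //.
by apply/rowP => i; rewrite !ord1 !mxE eqxx.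
Qed.

Lemma open_measurable_Rn n (O : set 'rV[R]_n) :
  open O -> measurable (O : set (Rn R n)).
Proof. by move=> oO; apply: sub_sigma_algebra. Qed.

Lemma dense_ball_Rn n (y : 'rV[R]_n) (e : R) : 0 < e ->
  exists v : 'rV[rat]_n, ball (map_mx ratr v : 'rV[R]_n) e y.
Proof.
move=> e0.
have H i : {q : rat | ball (ratr q : R) e (y ord0 i)}.
  apply: cid.
  have /rat_in_itvoo[q] : y ord0 i - e < y ord0 i + e.
    by rewrite ltrD2l gtrN.
  rewrite in_itv/= => /andP[h1 h2]; exists q.
  by rewrite /ball/= ltr_distlC ltrBlDr h2 -ltrBlDr h1.
exists (\row_i sval (H i)).
by split => // i j; rewrite !mxE (ord1 i); exact: (svalP (H j)).
Qed.

Lemma open_measurable_RRn n (O : set (R * 'rV[R]_n)) :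
  open O -> measurable (O : set (measurableTypeR R * Rn R n)).
Proof.
move=> oO.
pose B (q : rat * 'rV[rat]_n * rat) : set (measurableTypeR R * Rn R n) :=
  (ball (ratr q.1.1 : R) (ratr q.2)) `*`
  (ball (map_mx ratr q.1.2 : 'rV[R]_n) (ratr q.2)).
have -> : O = \bigcup_q (if `[< B q `<=` O >] then B q else set0).
  apply/seteqP; split => [[x y] Oxy|z [q _] /=]; last first.
    by case: ifPn => // /asboolP qO /qO.
  have /nbhs_ballP[e /= e0 eO] := open_nbhs_nbhs (conj oO Oxy).
  have /rat_in_itvoo[r] : 0 < e / 2 by rewrite divr_gt0.
  rewrite in_itv/= => /andP[r0 re].
  have /rat_in_itvoo[q] : x - ratr r < x + ratr r by rewrite ltrD2l gtrN.
  rewrite in_itv/= => /andP[q1 q2].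
  have [v vy] := dense_ball_Rn y r0.
  have qx : ball (ratr q : R) (ratr r) x.
    by rewrite /ball/= ltr_distlC ltrBlDr q2 -ltrBlDr q1.
  exists (q, v, r) => //=; case: ifPn => // /asboolP; case.
  move=> -[x' y'] [/= qx' vy']; apply: eO.
  have E : ratr r + ratr r <= e by rewrite [leRHS]splitr lerD// ltW.
  split => /=; apply: le_ball E _ _.
    by apply: ball_triangle qx'; exact: ball_sym.
  by apply: ball_triangle vy'; exact: ball_sym.
apply: countable_bigcupT_measurable => // q; case: ifPn => // _.
apply: measurableX.
  by apply: open_measurable; exact: ball_open.
by apply: open_measurable_Rn; exact: ball_open.
Qed.


Lemma continuous_Rn_cons n :
  continuous (@Rn_cons n : R * 'rV[R]_n -> 'rV[R]_n.+1).
Proof.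
move=> -[a v]; apply/cvg_ballP => e e0; exists (ball a e, ball v e).
  by split; exact: nbhsx_ballx.
move=> -[b w] [/= ab [_ vw]]; split => // i j.
rewrite !mxE; case: splitP => k _; last exact: vw.
by rewrite (ord1 i) (ord1 k) !mxE eqxx.
Qed.

Lemma continuous_rsubmx n :
  continuous (rsubmx : 'rV[R]_(1 + n) -> 'rV[R]_n).
Proof.
move=> x B /nbhs_ballP[e /= e0 eB]; apply/nbhs_ballP; exists e => //= y [_ xy].
by apply: eB; split => // i j; rewrite !mxE; exact: xy.
Qed.

Lemma measurable_Rn_cons n : measurable_fun setT (@Rn_cons n).
Proof.
apply: (measurability (@open 'rV[R]_n.+1 : set (set (Rn R n.+1)))) => //.
move=> _ [U oU <-]; rewrite setTI; apply: open_measurable_RRn.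
by apply: open_comp oU => z _; exact: continuous_Rn_cons.
Qed.

Lemma measurable_Rn_uncons n : measurable_fun setT (@Rn_uncons n).
Proof.
apply: measurable_fun_pair.
  apply: (measurability _ (RGenOpens.measurableE R)).
  move=> _ [_ [a [b ->]] <-]; rewrite setTI; apply: open_measurable_Rn.
  apply: open_comp; last exact: interval_open.
  by move=> x _; under eq_fun do rewrite mxE; exact: coord_continuous.
apply: (measurability (@open 'rV[R]_n : set (set (Rn R n)))) => //.
move=> _ [U oU <-]; rewrite setTI; apply: open_measurable_Rn.
by apply: open_comp oU => x _; exact: continuous_rsubmx.
Qed.

Section lebesgue_Rn_succ.
Variables (n : nat) (m : {sigma_finite_measure set (Rn R n) -> \bar R}).
Local Open Scope ereal_scope.

Definition lebesgue_Rn_succ : set (Rn R n.+1) -> \bar R :=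
  pushforward (@lebesgue_measure R \x m) (@Rn_cons n).

Let succ0 : lebesgue_Rn_succ set0 = 0.
Proof. by rewrite /lebesgue_Rn_succ /pushforward preimage_set0 measure0. Qed.

Let succ_ge0 A : 0 <= lebesgue_Rn_succ A.
Proof. exact: (measure_ge0 (@lebesgue_measure R \x m)). Qed.

Let succ_sigma_additive : semi_sigma_additive lebesgue_Rn_succ.
Proof.
move=> F mF tF mUF; rewrite /lebesgue_Rn_succ /pushforward preimage_bigcup.
apply: measure_semi_sigma_additive.
- by move=> k; rewrite -[X in measurable X]setTI; exact: measurable_Rn_cons.
- apply/trivIsetP => /= i j _ _ ij; rewrite -preimage_setI.
  by move/trivIsetP : tF => /(_ _ _ _ _ ij) ->//; rewrite preimage_set0.
- rewrite -preimage_bigcup -[X in measurable X]setTI.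
  exact: measurable_Rn_cons.
Qed.

HB.instance Definition _ := isMeasure.Build _ _ _ lebesgue_Rn_succ
  succ0 succ_ge0 succ_sigma_additive.

Let succ_sigma_finite : sigma_finite setT lebesgue_Rn_succ.
Proof.
have /sigma_finiteP[F [TF ndF Foo]] := sigma_finiteT (@lebesgue_measure R).
have /sigma_finiteP[G [TG ndG Goo]] := sigma_finiteT m.
exists (fun k => @Rn_uncons n @^-1` (F k `*` G k)).
  rewrite -preimage_bigcup -[LHS](@preimage_setT _ _ (@Rn_uncons n)).
  congr (_ @^-1` _); rewrite -setXTT TF TG predeqE => -[x y]; split.
    move=> [/= [k _ Fkx] [l _ Gly]]; exists (maxn k l) => //; split.
    - by move: x Fkx; exact/subsetPset/ndF/leq_maxl.
    - by move: y Gly; exact/subsetPset/ndG/leq_maxr.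
  by move=> [k _ []/= ? ?]; split; exists k.
move=> k; have [? ?] := Foo k; have [? ?] := Goo k; split.
  rewrite -[X in measurable X]setTI; apply: measurable_Rn_uncons => //.
  exact: measurableX.
rewrite /lebesgue_Rn_succ /pushforward -comp_preimage.
have -> : @Rn_uncons n \o @Rn_cons n = id by apply/funext => z; exact: Rn_consK.
by rewrite preimage_id product_measure1E// lte_mul_pinfty// ge0_fin_numE.
Qed.

HB.instance Definition _ := Measure_isSigmaFinite.Build _ _ _ lebesgue_Rn_succ
  succ_sigma_finite.

End lebesgue_Rn_succ.

Fixpoint lebesgue_Rn (n : nat) : {sigma_finite_measure set (Rn R n) -> \bar R} :=
  match n with
  | 0 => @dirac _ (Rn R 0) (0 : 'rV[R]_0) R
  | k.+1 => lebesgue_Rn_succ (lebesgue_Rn k)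
  end.

Lemma lebesgue_Rn_box n (a b : 'rV[R]_n) : (forall i, a ord0 i <= b ord0 i) ->
  lebesgue_Rn n [set x : 'rV[R]_n | forall i, x ord0 i \in `[a ord0 i, b ord0 i]] =
  (\prod_i (b ord0 i - a ord0 i))%:E.
Proof.
elim: n a b => [|n IHn] a b ab.
  by rewrite big_ord0 /= diracE mem_set// => -[].
pose box m (u v : 'rV[R]_m) : set (Rn R m) :=
  [set x : 'rV[R]_m | forall i, x ord0 i \in `[u ord0 i, v ord0 i]].
have mbox m u v : measurable (box m u v).
  rewrite -[box m u v]setCK; apply: measurableC; apply: open_measurable_Rn.
  rewrite openC (_ : (box m u v : set ('rV[R]_m)) = \bigcap_(i in setT)
    ((fun x : 'rV[R]_m => x ord0 i) @^-1` `[u ord0 i, v ord0 i])).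
    apply: closed_bigI => i _; apply: closed_comp; last exact: interval_closed.
    by move=> x _; exact: coord_continuous.
  by apply/seteqP; split => [x h i _|x h i]; exact: h.
pose a' : 'rV[R]_n := \row_i a ord0 (lift ord0 i).
pose b' : 'rV[R]_n := \row_i b ord0 (lift ord0 i).
have E : @Rn_cons n @^-1` box _ a b = `[a ord0 ord0, b ord0 ord0] `*` box _ a' b'.
  have cons0 (z : measurableTypeR R * Rn R n) : Rn_cons z ord0 ord0 = z.1.
    by rewrite mxE; case: splitP => [k _|//]; rewrite (ord1 k) mxE eqxx.
  have consS (z : measurableTypeR R * Rn R n) i :
      Rn_cons z ord0 (lift ord0 i) = (z.2 : 'rV[R]_n) ord0 i.
    rewrite mxE; case: splitP => [k|k /=]; first by rewrite (ord1 k).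
    by rewrite /bump/= => /addnI ik; congr (_ _ _); exact: val_inj.
  apply/seteqP; split => [z h|z [h1 h2] i].
    split; first by have := h ord0; rewrite cons0.
    by move=> i; have := h (lift ord0 i); rewrite consS !mxE.
  case: (unliftP ord0 i) => [k ->|->]; last by rewrite cons0.
  by rewrite consS; have := h2 k; rewrite !mxE.
rewrite /= /lebesgue_Rn_succ /pushforward E product_measure1E//.
rewrite IHn; last by move=> i; rewrite !mxE.
rewrite big_ord_recl EFinM; congr (_ * _)%E.
  rewrite [LHS](lebesgue_measure_itv `[a ord0 ord0, b ord0 ord0])/= lte_fin.
  case: ltP => // ba; congr EFin.
  by apply/esym/eqP; rewrite subr_eq0 eq_le ba ab.
by congr EFin; apply: eq_bigr => i _; rewrite !mxE.
Qed.

End lebesgue_Rn.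

Section manifold.
Context (R : realType) (n : nat) (M : topologicalType).

Definition loc_lipschitz (V W : normedModType R) (U : set V) (f : V -> W) :=
  forall x, U x -> exists2 N, nbhs x N & [lipschitz f y | y in N `&` U].

(* [cmap] is only meaningful on [cdom], and [cinv] only on the image of
   [cdom]. *)
Record chart := Chart {
  cdom : set M;
  cmap : M -> 'rV[R]_n;
  cinv : 'rV[R]_n -> M;
  cdom_open : open cdom;
  cimg_open : open (cmap @` cdom);
  cmapK : {in cdom, cancel cmap cinv};
  cmap_continuous : {in cdom, continuous cmap};
  cinv_continuous : {in cmap @` cdom, continuous cinv} }.

Implicit Types (c d : chart) (A : set chart).

Definition cimg c : set 'rV[R]_n := cmap c @` cdom c.

Definition transition c d : 'rV[R]_n -> 'rV[R]_n := cmap d \o cinv c.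

Definition overlap c d : set 'rV[R]_n := cmap c @` (cdom c `&` cdom d).

(* The first derivative is locally Lipschitz: a global Lipschitz bound on the
   overlaps would not be meaningful for a maximal atlas. *)
Definition C11_transition c d :=
  (forall x, overlap c d x -> differentiable (transition c d) x) /\
  loc_lipschitz (overlap c d) (jacobian (transition c d)).

Record C11_manifold A : Prop := {
  C11_hausdorff : hausdorff_space M;
  C11_second_countable : @second_countable M;
  C11_cover : forall p, exists2 c, A c & cdom c p;
  C11_compatible : forall c d, A c -> A d -> C11_transition c d;
  C11_maximal : forall c,
    (forall d, A d -> C11_transition c d /\ C11_transition d c) -> A c }.

(* A section of TM (x) D^w is given by its components in each chart of the
   atlas: [V c p ord0 j] is the coefficient v^j(p) in
     V = \sum_j v^j d/dx^j (x) (dx^1 ... dx^n)^w,   with x = cmap c.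
   Components are 0 where this is meaningless, so that a section is determined
   by its components. *)
Definition section := chart -> M -> 'rV[R]_n.

(* Row [i] of the Jacobian [J] of y = transition c d holds the dy^j/dx^i, and
   (dx^1 ... dx^n)^w = |det J|^(-w) (dy^1 ... dy^n)^w. *)
Record is_section A (w : R) (V : section) : Prop := {
  section_junk : forall c p, ~ (A c /\ cdom c p) -> V c p = 0;
  section_change : forall c d p, A c -> A d -> cdom c p -> cdom d p ->
    let J := jacobian (transition c d) (cmap c p) in
    V d p = `|\det J| `^ (- w) *: (V c p *m J) }.

Definition coord_fun (V : section) c (i : 'I_n) : 'rV[R]_n -> R :=
  fun x => V c (cinv c x) ord0 i.

Definition measurable_section A (w : R) (V : section) :=
  is_section A w V /\
  forall c i, A c -> measurable_fun (cimg c : set (Rn R n)) (coord_fun V c i).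

Definition lipschitz_section A (w : R) (V : section) :=
  is_section A w V /\
  forall c i, A c -> loc_lipschitz (cimg c) (coord_fun V c i : _ -> R^o).

Definition lipschitz_fun A (f : M -> R) :=
  forall c, A c -> loc_lipschitz (cimg c) (f \o cinv c : _ -> R^o).

Definition lipschitz_vector_field A := lipschitz_section A 0.
Definition measurable_vector_field A := measurable_section A 0.
Definition lipschitz_half_density A := lipschitz_section A 2^-1.

(* Sections are regarded up to null sets. *)
Definition ae_eq_section A (V W : section) :=
  forall c, A c -> {ae @lebesgue_Rn R n, forall x,
    cimg c x -> V c (cinv c x) = W c (cinv c x)}.

Definition addS (V W : section) : section := fun c p => V c p + W c p.
Definition scaleS (f : M -> R) (V : section) : section :=
  fun c p => f p *: V c p.

(* By Rademacher's theorem the partial derivatives of a Lipschitz function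
   exist almost everywhere; elsewhere the value below is irrelevant. *)
Definition pderiv (i : 'I_n) (f : 'rV[R]_n -> R) : 'rV[R]_n -> R :=
  fun x => 'D_(delta_mx ord0 i) (f : _ -> R^o) x.

Definition vf_apply (X : section) (f : M -> R) c (x : 'rV[R]_n) : R :=
  \sum_i coord_fun X c i x * pderiv i (f \o cinv c) x.

Definition lie_bracket (X Y : section) c (k : 'I_n) (x : 'rV[R]_n) : R :=
  \sum_i (coord_fun X c i x * pderiv i (coord_fun Y c k) x -
          coord_fun Y c i x * pderiv i (coord_fun X c k) x).

Record measurable_torsion_free_connection A
    (D : section -> section -> section) : Prop := {
  connection_measurable : forall X Y,
    lipschitz_vector_field A X -> lipschitz_vector_field A Y ->
    measurable_vector_field A (D X Y);
  connection_linearl : forall (a : R) X X' Y,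
    lipschitz_vector_field A X -> lipschitz_vector_field A X' ->
    lipschitz_vector_field A Y ->
    ae_eq_section A (D (addS (scaleS (cst a) X) X') Y)
                    (addS (scaleS (cst a) (D X Y)) (D X' Y));
  connection_linearr : forall (a : R) X Y Y',
    lipschitz_vector_field A X -> lipschitz_vector_field A Y ->
    lipschitz_vector_field A Y' ->
    ae_eq_section A (D X (addS (scaleS (cst a) Y) Y'))
                    (addS (scaleS (cst a) (D X Y)) (D X Y'));
  connection_tensorial : forall f X Y, lipschitz_fun A f ->
    lipschitz_vector_field A X -> lipschitz_vector_field A Y ->
    ae_eq_section A (D (scaleS f X) Y) (scaleS f (D X Y));
  connection_leibniz : forall f X Y, lipschitz_fun A f ->
    lipschitz_vector_field A X -> lipschitz_vector_field A Y ->
    forall c, A c -> {ae @lebesgue_Rn R n, forall x, cimg c x ->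
      forall k, coord_fun (D X (scaleS f Y)) c k x =
        vf_apply X f c x * coord_fun Y c k x + f (cinv c x) * coord_fun (D X Y) c k x};
  connection_torsion_free : forall X Y,
    lipschitz_vector_field A X -> lipschitz_vector_field A Y ->
    forall c, A c -> {ae @lebesgue_Rn R n, forall x, cimg c x ->
      forall k, coord_fun (D X Y) c k x - coord_fun (D Y X) c k x =
        lie_bracket X Y c k x} }.

Definition coordinate_field_on c (O : set M) (i : 'I_n) (X : section) :=
  forall p, O p -> X c p = delta_mx ord0 i.

(* [G k j i] is the Christoffel symbol \Gamma^k_{ji} of the chart [c], as a
   function of the coordinates, i.e. D_{d_i} d_j = \sum_k \Gamma^k_{ji} d_k.
   As the coordinate fields d_i are only defined on [cdom c], the connection is
   applied to global fields which agree with them on open subsets.  Such [G]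
   exist and are unique up to null sets, by the locality of D. *)
Record is_christoffel A (D : section -> section -> section) c
    (G : 'I_n -> 'I_n -> 'I_n -> 'rV[R]_n -> R) : Prop := {
  christoffel_measurable : forall k j i,
    measurable_fun (cimg c : set (Rn R n)) (G k j i);
  christoffelE : forall i j X Y O,
    lipschitz_vector_field A X -> lipschitz_vector_field A Y ->
    open O -> O `<=` cdom c ->
    coordinate_field_on c O i X -> coordinate_field_on c O j Y ->
    {ae @lebesgue_Rn R n, forall x, (cmap c @` O) x ->
      forall k, coord_fun (D X Y) c k x = G k j i x} }.

Definition nabla_half_density (G : 'I_n -> 'I_n -> 'I_n -> 'rV[R]_n -> R)
    (V : section) c (i j : 'I_n) (x : 'rV[R]_n) : R :=
  pderiv i (coord_fun V c j) x + \sum_k G j k i x * coord_fun V c k x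
  - 2^-1 * (\sum_k G k k i x) * coord_fun V c j x.

(* The integrand of Q(V, W) in the chart [c]: the coefficient of
   dx^1 ... dx^n *)
Definition Q_integrand (G : 'I_n -> 'I_n -> 'I_n -> 'rV[R]_n -> R)
    (V W : section) c (x : 'rV[R]_n) : R :=
  \sum_i \sum_j
    (nabla_half_density G V c i i x * nabla_half_density G W c j j x -
     nabla_half_density G V c i j x * nabla_half_density G W c j i x).

Definition vanishes_off (K : set M) (V : section) :=
  forall c p, ~ K p -> V c p = 0.

Record partition_of_unity_on A (K : set M) (m : nat)
    (c : 'I_m -> chart) (chi : 'I_m -> M -> R) : Prop := {
  pou_atlas : forall a, A (c a);
  pou_continuous : forall a, continuous (chi a);
  pou_ge0 : forall a p, 0 <= chi a p;
  pou_support : forall a, exists L, [/\ compact L, L `<=` cdom (c a) &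
    forall p, ~ L p -> chi a p = 0];
  pou_sum : forall p, K p -> \sum_a chi a p = 1 }.

(* A density supported in a compact set [K] is integrable when, given a
   partition of unity on [K] subordinate to charts, each of its pieces is
   integrable in the corresponding chart.  Such partitions always exist;
   neither their choice nor that of the representatives [G] of the Christoffel
   symbols matters. *)
Definition tame A (D : section -> section -> section) :=
  forall V W K,
    lipschitz_half_density A V -> lipschitz_half_density A W ->
    compact K -> vanishes_off K V -> vanishes_off K W ->
  forall m (c : 'I_m -> chart) (chi : 'I_m -> M -> R),
    partition_of_unity_on A K c chi ->
  forall a G, is_christoffel A D (c a) G ->
    (@lebesgue_Rn R n).-integrable (cimg (c a) : set (Rn R n))
      (fun x => (chi a (cinv (c a) x) * Q_integrand G V W (c a) x)%:E).

Definition locally_integrable_on (U : set 'rV[R]_n) (f : 'rV[R]_n -> R) :=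
  measurable_fun (U : set (Rn R n)) f /\
  forall K : set 'rV[R]_n, compact K -> K `<=` U ->
    (@lebesgue_Rn R n).-integrable (K : set (Rn R n)) (EFin \o f).

End manifold.

(* Main.v *)
Require Import Defs.
From HB Require Import structures.
From mathcomp Require Import all_boot all_order all_algebra.
From mathcomp Require Import all_classical all_reals all_analysis.
From mathcomp Require Import measurable_realfun ring lra.

Set Implicit Arguments.
Unset Strict Implicit.
Unset Printing Implicit Defensive.

Import Order.TTheory GRing.Theory Num.Theory.
Import numFieldNormedType.Exports.
Local Open Scope classical_set_scope.
Local Open Scope ring_scope.

(** In a chart, nabla_i v^j = d_i v^j + B(v)_i^j, where
      B(v)_i^j = sum_k Gamma^j_{ki} v^k - 1/2 a_i v^j,  a_i = sum_k Gamma^k_{ki},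
    and the integrand of Q is the symmetric bilinear form [p, q] = tr p tr q - tr (p q)
    evaluated at p = nabla v and q = nabla w.  It therefore splits as
      [dv, dw] + [dv, B(w)] + [dw, B(v)] + [B(v), B(w)].
    The connection being torsion-free, Gamma is symmetric almost everywhere
    (lemma [christoffel_sym]).  With this symmetry, and because the weight is exactly
    1/2, all products of two traces a_i in the last term cancel, and
      [B(v), B(w)] = sum_{k,l} v^k w^l R_{kl},
    where R_{kl} is the expression of the statement, that is, the part of the Ricci
    tensor that is quadratic in Gamma (lemma [trace_form_zeroth_part]).

    If Gamma and R are locally integrable, all four terms are: v, w and their partial
    derivatives are locally bounded and measurable, so that the terms are bounded,
    bounded times Gamma, and bounded times R (lemma [Q_locally_integrable]).
    A compactly supported cutoff then makes the product integrable.

    Conversely, let the connection be tame.  Near a given point, the constant fields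
    v = e_k and w = e_l have integrand R_{kl}, hence R_{kl} is integrable there.
    Replacing v by x^p e_k, the integrand is x^p R_{kl} plus the first order term
      [dv, B(w)] = 1/2 delta_{pk} a_l + 1/2 delta_{pl} a_k - Gamma^p_{lk},
    which is thus integrable as well (lemma [mixed_loc_integrable]).  Contracting p
    with k gives (n - 1)/2 a_l; since n > 1 the a_l are integrable, and then so are the
    Gamma^p_{lk} themselves.

    The rest justifies the words used above on a C^{1,1} manifold: a field given in one
    chart by Lipschitz components with compact support, extended by zero, is Lipschitz
    in every chart (lemma [lipschitz_chart_section]), because the transition maps are
    locally Lipschitz along with their Jacobians; and the partial derivatives of a
    continuous function, set to an arbitrary constant where they do not exist, are
    Borel functions (lemma [measurable_pderiv]). *)

Local Notation loc_integrable := locally_integrable_on.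

(** * Local integrability *)

(** Otherwise the sets S such that P (K \ S) would form a proper filter containing K,
    without cluster point in K since P holds locally. *)
Lemma compact_induction (T : topologicalType) (P : set T -> Prop) (K : set T) :
  P set0 -> (forall A B, P A -> P B -> P (A `|` B)) ->
  (forall A B, A `<=` B -> P B -> P A) ->
  (forall x, K x -> exists2 N, nbhs x N & P N) -> compact K -> P K.
Proof.
move=> P0 PU PS Ploc cK; apply: contrapT => nPK.
pose F : set_system T := fun S => P (K `\` S).
have FF : ProperFilter F.
  split=> [F0|]; first by apply: nPK; move: F0; rewrite /F setD0.
  split => [|S S' FS FS'|S S' SS']; rewrite /F.
  - by rewrite setDT.
  - by rewrite setDIr; exact: PU.
  - by apply: PS => x [Kx nS']; split => // /SS'.
have FK : F K by rewrite /F setDv.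
have [x [Kx clx]] := cK F FF FK.
have [N xN PN] := Ploc x Kx.
have FN : F (~` N) by apply: PS PN => y [_ /contrapT].
by have [y []] := clx _ _ FN xN.
Qed.

Section local_integrability.
Context (R : realType) (n : nat).
Implicit Types (U K : set 'rV[R]_n) (f g h : 'rV[R]_n -> R).
Local Notation mu := (@lebesgue_Rn R n).

Lemma ae_imp (P Q : 'rV[R]_n -> Prop) : (forall x, P x -> Q x) ->
  {ae mu, forall x, P x} -> {ae mu, forall x, Q x}.
Proof. by move=> PQ; apply: negligibleS => x /= nQ /PQ. Qed.

Lemma ae_and (P Q : 'rV[R]_n -> Prop) :
  {ae mu, forall x, P x} -> {ae mu, forall x, Q x} ->
  {ae mu, forall x, P x /\ Q x}.
Proof.
move=> nP nQ; apply: negligibleS (negligibleU nP nQ) => x /= nPQ.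
by apply: contrapT => /not_orP[/contrapT Px /contrapT Qx]; exact: nPQ.
Qed.

Lemma rV_hausdorff : hausdorff_space 'rV[R]_n.
Proof. exact: norm_hausdorff. Qed.

Lemma measurable_compact_Rn K : compact K -> measurable (K : set (Rn R n)).
Proof.
move=> /(compact_closed rV_hausdorff) cK; rewrite -[K]setCK.
by apply: measurableC; apply: open_measurable_Rn; rewrite openC.
Qed.

Lemma measurable_continuous_Rn U f : open U -> {in U, continuous (f : _ -> R^o)} ->
  measurable_fun (U : set (Rn R n)) f.
Proof.
move=> oU cf; apply: (measurability _ (RGenOpens.measurableE R)).
move=> _ [_ [a [b ->]] <-]; apply: open_measurable_Rn.
rewrite openE => x [Ux fx]; apply: filterI; first exact: open_nbhs_nbhs.
apply: (cf x (mem_set Ux)); apply: open_nbhs_nbhs; split => //.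
Qed.

(** Multiplication by such functions preserves local integrability. *)
Definition loc_bounded U f := measurable_fun (U : set (Rn R n)) f /\
  forall K, compact K -> K `<=` U -> exists k, forall x, K x -> `|f x| <= k.

Lemma loc_boundedP U f : measurable_fun (U : set (Rn R n)) f ->
  (forall x, U x -> exists k, \forall y \near x, `|f y| <= k) -> loc_bounded U f.
Proof.
move=> mf Hloc; split => // K cK KU.
apply: (@compact_induction _ (fun A => exists k, forall y, A y -> `|f y| <= k) K)
  => //.
- by exists 0.
- move=> A B [k Hk] [l Hl]; exists (Num.max k l) => y [/Hk|/Hl] h.
    by rewrite le_max h.
  by rewrite le_max h orbT.
- by move=> A B AB [k Hk]; exists k => y /AB /Hk.
- move=> x /KU /Hloc[k Hk]; exists [set y | `|f y| <= k] => //.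
  by exists k.
Qed.

Lemma loc_bounded_cst U c : loc_bounded U (fun=> c).
Proof. by split=> [|K _ _]; [exact: measurable_cst|exists `|c|]. Qed.

Lemma loc_boundedM U f g :
  loc_bounded U f -> loc_bounded U g -> loc_bounded U (fun x => f x * g x).
Proof.
move=> [mf bf] [mg bg]; split; first exact: measurable_funM.
move=> K cK KU; have [k Hk] := bf K cK KU; have [l Hl] := bg K cK KU.
exists (k * l) => x Kx; rewrite normrM ler_pM//; [exact: Hk|exact: Hl].
Qed.

Lemma compact_fin_measure K : compact K -> (mu (K : set (Rn R n)) < +oo)%E.
Proof.
move=> cK; have [M [_ HM]] := compact_bounded cK.
pose B := `|M| + 1.
have B0 : 0 <= B by rewrite addr_ge0.
pose b : 'rV[R]_n := \row__ B.
have mbox : measurable ([set x : 'rV[R]_n |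
    forall i, x ord0 i \in `[(- b) ord0 i, b ord0 i]] : set (Rn R n)).
  apply: measurable_compact_Rn.
  apply: (@rV_compact _ _ (fun i => `[(- b) ord0 i, b ord0 i]%classic)).
  by move=> i; exact: segment_compact.
apply: (@le_lt_trans _ _ (mu [set x : 'rV[R]_n |
    forall i, x ord0 i \in `[(- b) ord0 i, b ord0 i]])).
  apply: le_measure; rewrite ?inE//; first exact: measurable_compact_Rn.
  move=> x Kx i; rewrite in_itv/= !mxE -ler_norml.
  apply: le_trans (HM B _ x Kx); last by rewrite ltr_pwDr// ler_norm.
  rewrite [leRHS]mx_normrE.
  by apply/bigmax_geP; right; exists (ord0, i).
rewrite lebesgue_Rn_box ?ltry// => i; rewrite !mxE.
by rewrite (le_trans _ B0)// oppr_le0.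
Qed.

Lemma loc_integrable_cst U c : measurable (U : set (Rn R n)) -> loc_integrable U (fun=> c).
Proof.
move=> mU; split; first exact: measurable_cst.
move=> K cK KU; apply: measurable_bounded_integrable => //.
- exact: measurable_compact_Rn.
- exact: compact_fin_measure.
- exact: bounded_cst.
Qed.

Lemma loc_integrableD U f g :
  loc_integrable U f -> loc_integrable U g -> loc_integrable U (fun x => f x + g x).
Proof.
move=> [mf If] [mg Ig]; split; first exact: measurable_funD.
move=> K cK KU; have mK := measurable_compact_Rn cK.
by apply: eq_integrable (integrableD mK (If K cK KU) (Ig K cK KU)).
Qed.

Lemma loc_integrableM U f g : measurable (U : set (Rn R n)) ->
  loc_bounded U f -> loc_integrable U g -> loc_integrable U (fun x => f x * g x).
Proof.
move=> mU [mf bf] [mg Ig]; split; first exact: measurable_funM.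
move=> K cK KU; have mK := measurable_compact_Rn cK.
have [k Hk] := bf K cK KU.
have := @integrableMr _ _ _ mu _ mK f _ _ _ (Ig K cK KU).
apply.
  exact: (measurable_funS mU KU mf).
exists k; split; first exact: num_real.
by move=> l kl x /Hk h; apply: le_trans h (ltW kl).
Qed.

Lemma loc_bounded_integrable U f : measurable (U : set (Rn R n)) ->
  loc_bounded U f -> loc_integrable U f.
Proof.
move=> mU bf; have := loc_integrableM mU bf (loc_integrable_cst 1 mU).
by under eq_fun do rewrite mulr1.
Qed.

Lemma loc_integrableZ U c f : measurable (U : set (Rn R n)) ->
  loc_integrable U f -> loc_integrable U (fun x => c * f x).
Proof. by move=> mU; apply: loc_integrableM => //; exact: loc_bounded_cst. Qed.

Lemma loc_integrableB U f g : measurable (U : set (Rn R n)) ->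
  loc_integrable U f -> loc_integrable U g -> loc_integrable U (fun x => f x - g x).
Proof.
move=> mU If Ig; have := loc_integrableD If (loc_integrableZ (-1) mU Ig).
by under eq_fun do rewrite mulN1r.
Qed.

Lemma loc_integrable_sum U (I : Type) (r : seq I) (F : I -> 'rV[R]_n -> R) :
  measurable (U : set (Rn R n)) ->
  (forall i, loc_integrable U (F i)) -> loc_integrable U (fun x => \sum_(i <- r) F i x).
Proof.
move=> mU HF; elim: r => [|a r IH].
  by under eq_fun do rewrite big_nil; exact: loc_integrable_cst.
by under eq_fun do rewrite big_cons; exact: loc_integrableD.
Qed.

Lemma ae_integrable (V : set 'rV[R]_n) f g : measurable (V : set (Rn R n)) ->
  measurable_fun (V : set (Rn R n)) g ->
  {ae mu, forall x, V x -> f x = g x} ->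
  mu.-integrable (V : set (Rn R n)) (EFin \o f) ->
  mu.-integrable (V : set (Rn R n)) (EFin \o g).
Proof.
move=> mV mg [N [mN N0 HN]] If.
have mf : measurable_fun (V : set (Rn R n)) (EFin \o f) by case/integrableP : If.
apply/(negligible_integrable mN mV _ N0); first exact/measurable_EFinP.
have {}If := (negligible_integrable mN mV mf N0).1 If.
apply: eq_integrable If; first exact: measurableD.
move=> x; rewrite inE => -[Vx nNx] /=; congr EFin.
by apply: contrapT => fg; apply: nNx; apply: HN => /= /(_ Vx).
Qed.

Lemma loc_integrable_ae U f g : measurable (U : set (Rn R n)) ->
  loc_integrable U f -> measurable_fun (U : set (Rn R n)) g ->
  {ae mu, forall x, U x -> f x = g x} -> loc_integrable U g.
Proof.
move=> mU [mf If] mg fg; split => // K cK KU; have mK := measurable_compact_Rn cK.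
apply: ae_integrable mK _ _ (If K cK KU); first exact: (measurable_funS mU KU mg).
by apply: ae_imp fg => x h /KU.
Qed.

(** On the union, |f| is at most the sum of the restrictions of |f| to the two sets. *)
Lemma integrable_union (V W : set 'rV[R]_n) f :
  measurable (V : set (Rn R n)) -> measurable (W : set (Rn R n)) ->
  mu.-integrable (V : set (Rn R n)) (EFin \o f) ->
  mu.-integrable (W : set (Rn R n)) (EFin \o f) ->
  mu.-integrable (V `|` W : set (Rn R n)) (EFin \o f).
Proof.
move=> mV mW IV IW; have mVW := measurableU _ _ mV mW.
have mf : measurable_fun (V `|` W : set (Rn R n)) (EFin \o f).
  by apply/measurable_funU => //; split; [case/integrableP: IV|case/integrableP: IW].
have IVW (X : set (Rn R n)) : measurable X -> X `<=` V `|` W ->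
    mu.-integrable X (EFin \o f) ->
    mu.-integrable (V `|` W : set (Rn R n)) (abse \o ((EFin \o f) \_ X)).
  move=> mX sX IX; apply: integrable_abse => //.
  by apply/integrable_restrict => //; rewrite setIidr.
apply: (le_integrable _ _ _ (integrableD mVW
  (IVW V mV (@subsetUl _ _ _) IV) (IVW W mW (@subsetUr _ _ _) IW))) => //.
have restr (X : set (Rn R n)) y : X y -> ((EFin \o f) \_ X) y = (f y)%:E.
  by move=> Xy; rewrite patchE mem_set.
move=> x VWx; rewrite /= [leRHS]gee0_abs ?adde_ge0//.
by case: VWx => h; rewrite (restr _ _ h) ?leeDl ?leeDr.
Qed.

Lemma compact_closed_ball_Rn (x : 'rV[R]_n) (e : R) : 0 < e ->
  compact (closed_ball x e).
Proof.
move=> e0; apply: bounded_closed_compact; last exact: closed_ball_closed.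
exists (`|x| + e); split; first exact: num_real.
move=> k kxe y; rewrite closed_ballE// /closed_ball_ /= => xy.
apply: le_trans (ltW kxe).
by rewrite -[y](subKr x) (le_trans (ler_normB _ _))// lerD2l.
Qed.

Lemma open_closed_ball (V : set 'rV[R]_n) (x : 'rV[R]_n) : nbhs x V ->
  exists2 e, 0 < e & closed_ball x e `<=` V.
Proof.
move=> /nbhs_ballP[e /= e0 eV]; exists (e / 2); first by rewrite divr_gt0.
move=> y yx; apply: eV; move: y yx; apply: closed_ball_subset.
  by rewrite divr_gt0.
by rewrite ltr_pdivrMr// ltr_pMr// ltr1n.
Qed.

(** Allows the necessity part to be proved on small balls only. *)
Lemma loc_integrable_local U f : measurable_fun (U : set (Rn R n)) f ->
  (forall x, U x -> exists2 V, open_nbhs x V & loc_integrable V f) -> loc_integrable U f.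
Proof.
move=> mf H; split => // K cK KU.
pose P (S : set 'rV[R]_n) := exists C : set 'rV[R]_n,
  [/\ S `<=` C, measurable (C : set (Rn R n)) &
      mu.-integrable (C : set (Rn R n)) (EFin \o f)].
have : P K.
  apply: compact_induction cK.
  - by exists set0; split => //; exact: integrable_set0.
  - move=> A B [C [AC mC IC]] [D [BD mD ID]]; exists (C `|` D); split.
    + exact: setUSS.
    + exact: measurableU.
    + exact: integrable_union.
  - by move=> A B AB [C [BC mC IC]]; exists C; split => // x /AB /BC.
  - move=> x /KU Ux; have [V [oV Vx] [_ IV]] := H x Ux.
    have [e e0 eV] := open_closed_ball (open_nbhs_nbhs (conj oV Vx)).
    exists (closed_ball x e).
      by apply: filterS (@subset_closed_ball _ _ x e) _; exact: nbhsx_ballx.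
    exists (closed_ball x e); split => //.
      by apply: measurable_compact_Rn; exact: compact_closed_ball_Rn.
    by apply: IV => //; exact: compact_closed_ball_Rn.
move=> [C [KC mC IC]]; apply: integrableS mC _ KC IC.
exact: measurable_compact_Rn.
Qed.

(** The Lindelof property of R^n: countably many balls with rational centre and
    radius suffice to cover U by sets on which P holds almost everywhere. *)
Lemma ae_local U (P : 'rV[R]_n -> Prop) :
  (forall x, U x -> exists2 V, nbhs x V & {ae mu, forall y, V y -> P y}) ->
  {ae mu, forall y, U y -> P y}.
Proof.
move=> H.
pose B (q : 'rV[rat]_n * rat) : set (Rn R n) :=
  ball (map_mx ratr q.1 : 'rV[R]_n) (ratr q.2).
pose N (q : 'rV[rat]_n * rat) : set (Rn R n) :=
  if `[< {ae mu, forall y, B q y -> P y} >] then B q `\` P else set0.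
have NN q : mu.-negligible (N q).
  rewrite /N; case: ifPn => [/asboolP|_]; last exact: negligible_set0.
  apply: negligibleS => y [By nPy] /= h; exact/nPy/h.
pose F k : set (Rn R n) := if unpickle k is Some q then N q else set0.
have : mu.-negligible (\bigcup_k F k).
  apply: negligible_bigcup => k; rewrite /F; case: unpickle => // .
  exact: negligible_set0.
apply: negligibleS => y /= /not_implyP[Uy nPy].
have [V /nbhs_ballP[e /= e0 eV] aeV] := H y Uy.
have /rat_in_itvoo[r] : 0 < e / 2 by rewrite divr_gt0.
rewrite in_itv/= => /andP[r0 re].
have [v vy] := @dense_ball_Rn R n y _ r0.
exists (pickle (v, r)) => //; rewrite /F pickleK /N ifT.
  by split.
apply/asboolP; apply: ae_imp aeV => z h Bz; apply: h; apply: eV.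
have E : ratr r + ratr r <= e by rewrite [leRHS]splitr lerD// ltW.
apply: le_ball E _ _.
by apply: ball_triangle Bz; exact: ball_sym.
Qed.

End local_integrability.

(** * Germs of Lipschitz functions *)

Section lipschitz_germs.
Context (R : realType).

(** The germ at x of a locally Lipschitz function.  Quantifying over a neighbourhood
    of the diagonal point (x, x) makes this stable under composition and insensitive to
    the values of f away from x. *)
Definition lip_at (V W : normedModType R) (f : V -> W) (x : V) :=
  exists k : R, \forall p \near (x, x), `|f p.1 - f p.2| <= k * `|p.1 - p.2|.

Section generic.
Context (V W : normedModType R).
Implicit Types (f g : V -> W) (x : V).

Lemma lip_at_pos f x : lip_at f x -> exists2 k : R, 0 <= k &
  \forall p \near (x, x), `|f p.1 - f p.2| <= k * `|p.1 - p.2|.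
Proof.
move=> [k Hk]; exists `|k| => //; apply: filterS Hk => p /le_trans; apply.
by rewrite ler_wpM2r// ler_norm.
Qed.

Lemma near_pair x (P : V -> Prop) : (\forall y \near x, P y) ->
  \forall p \near (x, x), P p.1 /\ P p.2.
Proof.
by move=> xP; exists (P, P) => // -[y z] /= [Py Pz]; split.
Qed.

Lemma loc_lipschitzP (U : set V) f : open U ->
  loc_lipschitz U f <-> forall x, U x -> lip_at f x.
Proof.
move=> oU; split => H x Ux.
  have [N xN [k [_ /(_ (k + 1))]]] := H x Ux.
  rewrite ltrDl ltr01 => /(_ erefl) Hk; exists (k + 1).
  have xU : nbhs x U by exact: open_nbhs_nbhs.
  apply: filterS (near_pair (filterI xN xU)) => p [p1 p2].
  exact: (Hk p (conj p1 p2)).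
have [k [[N1 N2] /= [xN1 xN2] HN]] := H x Ux.
exists (N1 `&` N2); first exact: filterI.
apply: (@klipschitzW _ _ _ k).
  apply: (@globally_properfilter _ _ (x, x)).
  by split; split => //; split; exact: nbhs_singleton.
move=> [y z] /= [[[y1 _] _] [[_ z2] _]].
by apply: (HN (y, z)).
Qed.

Lemma lip_at_near f g x : (\forall y \near x, f y = g y) ->
  lip_at f x -> lip_at g x.
Proof.
move=> /near_pair fg [k Hk]; exists k.
by apply: filterS2 fg Hk => p [-> ->].
Qed.

Lemma lip_at_cst (c : W) x : lip_at (fun=> c) x.
Proof. by exists 0; near=> p; rewrite subrr normr0 mul0r.
Unshelve. all: by end_near. Qed.

Lemma lip_at_continuous f x : lip_at f x -> {for x, continuous f}.
Proof.
move=> /lip_at_pos[k k0 [[N1 N2] /= [xN1 xN2] HN]].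
apply/cvgrPdist_le => e e0.
have k1 : 0 < k + 1 by rewrite ltr_wpDl.
have xe : \forall y \near x, `|x - y| < e / (k + 1).
  apply/nbhs_ballP; exists (e / (k + 1)); first by rewrite /= divr_gt0.
  by move=> y; rewrite -ball_normE.
apply: filterS2 xN2 xe => y y2 xy.
have /= := HN (x, y) (conj (nbhs_singleton xN1) y2); move/le_trans; apply.
apply: (@le_trans _ _ (k * (e / (k + 1)))); first by rewrite ler_wpM2l// ltW.
by rewrite mulrCA ler_piMr// ?ltW// ltr_pdivrMr// mul1r ltrDl.
Qed.

Lemma lip_at_bounded f x : lip_at f x ->
  exists2 k : R, 0 <= k & \forall y \near x, `|f y| <= k.
Proof.
move=> /lip_at_continuous; rewrite /continuous_at => cf.
exists (`|f x| + 1); first by rewrite addr_ge0.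
have /cvgrPdist_le/(_ 1 ltr01) := cf; apply: filterS => y fxy.
rewrite -[f y](subKr (f x)); apply: le_trans (ler_normB _ _) _.
by rewrite lerD2l.
Qed.

Lemma lip_atD f g x : lip_at f x -> lip_at g x -> lip_at (fun y => f y + g y) x.
Proof.
move=> [k Hk] [l Hl]; exists (k + l).
apply: filterS2 Hk Hl => p hk hl.
rewrite opprD addrACA; apply: le_trans (ler_normD _ _) _.
by rewrite mulrDl lerD.
Qed.

End generic.

Lemma lip_at_comp (V W Z : normedModType R) (f : V -> W) (g : W -> Z) x :
  lip_at f x -> lip_at g (f x) -> lip_at (fun y => g (f y)) x.
Proof.
move=> lf; have cf := lip_at_continuous lf; move: lf => [k Hk].
move=> /lip_at_pos[l l0 [[N1 N2] /= [xN1 xN2] HN]]; exists (l * k).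
have xN : nbhs x (f @^-1` (N1 `&` N2)) by apply: cf; exact: filterI.
apply: filterS2 (near_pair xN) Hk => p [[p1 _] [_ p2]] hk.
have /= := HN (f p.1, f p.2) (conj p1 p2); move/le_trans; apply.
by rewrite -mulrA ler_wpM2l.
Qed.

Lemma mvt01 (g dg : R -> R) :
  (forall t : R, t \in `[0, 1]%R -> is_derive t 1 g (dg t)) ->
  exists2 c, c \in `[0, 1]%R & g 1 - g 0 = dg c.
Proof.
move=> Hg.
have le01 : (0 : R) <= 1 by exact: ler01.
have H := MVT_segment le01.
have {}H := H g dg.
have H1 : forall x : R, x \in `]0, 1[ -> is_derive x 1 g (dg x).
  by move=> t t01; apply: Hg; exact: subset_itv_oo_cc.
have {}H := H H1.
have H2 : {within `[0, 1], continuous g}.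
  by apply: derivable_within_continuous => t /Hg[].
have [c c01 E] := H H2.
by exists c; rewrite // E subr0 mulr1.
Qed.

Section scalar.
Context (V : normedModType R).
Implicit Types (f g : V -> R^o) (x : V).

Lemma lip_atM f g x : lip_at f x -> lip_at g x ->
  lip_at (fun y => f y * g y : R^o) x.
Proof.
move=> lf lg; have [bf bf0 Hbf] := lip_at_bounded lf.
have [bg bg0 Hbg] := lip_at_bounded lg.
have [k k0 Hk] := lip_at_pos lf; have [l l0 Hl] := lip_at_pos lg.
exists (bf * l + bg * k).
apply: filterS3 (near_pair (filterI Hbf Hbg)) Hk Hl => -[y z] /=.
move=> [[fy _] [_ gz]] hk hl.
have -> : f y * g y - f z * g z = f y * (g y - g z) + (f y - f z) * g z.
  by rewrite mulrBr mulrBl addrA subrK.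
apply: le_trans (ler_normD _ _) _; rewrite !normrM mulrDl lerD//.
  by rewrite -mulrA ler_pM.
by rewrite -mulrA [leRHS]mulrC ler_pM.
Qed.

Lemma lip_at_sum (I : Type) (r : seq I) (P : pred I) (F : I -> V -> R^o) x :
  (forall i, lip_at (F i) x) -> lip_at (fun y => \sum_(i <- r | P i) F i y : R^o) x.
Proof.
move=> HF; elim: r => [|a r IH].
  by under eq_fun do rewrite big_nil; exact: lip_at_cst.
have [Pa|/negbTE Pa] := boolP (P a).
  by under eq_fun do rewrite big_cons Pa; exact: lip_atD.
by under eq_fun do rewrite big_cons Pa.
Qed.

Lemma lip_at_prod (I : Type) (r : seq I) (F : I -> V -> R^o) x :
  (forall i, lip_at (F i) x) -> lip_at (fun y => \prod_(i <- r) F i y : R^o) x.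
Proof.
move=> HF; elim: r => [|a r IH].
  by under eq_fun do rewrite big_nil; exact: lip_at_cst.
by under eq_fun do rewrite big_cons; exact: lip_atM.
Qed.

Lemma lip_at_norm (f : V -> R^o) x : lip_at f x -> lip_at (fun y => `|f y| : R^o) x.
Proof.
move=> [k Hk]; exists k; apply: filterS Hk => p; apply: le_trans.
exact: ler_dist_dist.
Qed.

(** Mean value inequality along segments, balls being convex. *)
Lemma lip_at_diff f x (k : R) :
  (\forall y \near x, differentiable f y /\ forall v, `|'d f y v| <= k * `|v|) ->
  lip_at f x.
Proof.
move=> /nbhs_ballP[e /= e0 He]; exists k.
have xe : nbhs x (ball x e) by exact: nbhsx_ballx.
apply: filterS (near_pair xe) => -[y z] /= [xy xz].
pose l (t : R^o) : V := z + t *: (y - z).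
have dl (t : R) : is_diff (t : R^o) l (fun h : R^o => h *: (y - z)).
  rewrite /l; apply: is_diff_eq.
  by apply/funext => h /=; rewrite add0r.
have lb (t : R) : t \in `[0, 1]%R -> ball x e (l t).
  rewrite in_itv/= => /andP[t0 t1].
  have -> : l t = t *: y + (1 - t) *: z.
    by rewrite /l scalerBr scalerBl scale1r addrCA.
  rewrite -ball_normE/=.
  have -> : x - (t *: y + (1 - t) *: z) = t *: (x - y) + (1 - t) *: (x - z).
    by rewrite !scalerBr addrACA -scalerDl [t + _]addrC subrK scale1r opprD.
  apply: le_lt_trans (ler_normD _ _) _; rewrite !normrZ.
  rewrite (ger0_norm t0) ger0_norm ?subr_ge0//.
  move: xy xz; rewrite -ball_normE/= => xy xz.
  have [t00|tp] := eqVneq t 0; first by rewrite t00 mul0r add0r subr0 mul1r.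
  rewrite [ltRHS](_ : _ = t * e + (1 - t) * e); last first.
    by rewrite -mulrDl [t + _]addrC subrK mul1r.
  apply: ltr_leD; last by rewrite ler_wpM2l ?subr_ge0// ltW.
  by rewrite ltr_pM2l// lt_neqAle eq_sym tp.
have dg (t : R) : t \in `[0, 1]%R ->
    is_derive (t : R^o) (1 : R^o) (f \o l : R^o -> R^o) ('d f (l t) (y - z)).
  move=> /lb /He[df _].
  have dlt : differentiable (l : R^o -> V) t by case: (dl t).
  have dfl : differentiable (f \o l : R^o -> R^o) t by apply: differentiable_comp.
  apply: DeriveDef; first exact: (diff_derivable dfl).
  rewrite (deriveE _ dfl) (diff_comp dlt df) /=; congr ('d f (l t) _).
  by rewrite (@diff_val _ _ _ _ _ _ _ (dl t)) scale1r.
have [c c01] := mvt01 dg.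
rewrite /l /= scale1r scale0r addr0 [z + _]addrC subrK => ->.
by apply: (He _ (lb c c01)).2.
Qed.

End scalar.

(** The derivative a x^(a-1) is continuous, hence bounded near y. *)
Lemma lip_at_powR (a y : R) : 0 < y -> lip_at (fun x : R^o => x `^ a : R^o) y.
Proof.
move=> y0.
have cd : {for y, continuous (fun x : R^o => x `^ (a - 1) : R^o)}.
  apply: differentiable_continuous; apply/derivable1_diffP.
  by have [] := is_derive1_powR (a - 1) y0.
have [k Hk] : exists k, \forall x \near (y : R^o), `|x `^ (a - 1)| <= k.
  exists (`|y `^ (a - 1)| + 1).
  have /cvgrPdist_le/(_ 1 ltr01) := cd; apply: filterS => x fxy.
  rewrite -[x `^ _](subKr (y `^ (a - 1))); apply: le_trans (ler_normB _ _) _.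
  by rewrite lerD2l.
apply: (@lip_at_diff _ _ _ (`|a| * k)).
have x0 : \forall x \near (y : R^o), 0 < x by exact: lt_nbhsr.
apply: filterS2 x0 Hk => x x0 Hk.
have [D1 D2] := is_derive1_powR a x0.
have dx : differentiable (fun x : R^o => x `^ a : R^o) x by apply/derivable1_diffP.
split => // v.
rewrite (diff1E dx) derive1E D2 /= normrM mulrC ler_wpM2r// normrM.
by rewrite ler_wpM2l.
Qed.

Lemma mx_entry_norm m n (x : 'M[R]_(m, n)) i j : `|x i j| <= `|x|.
Proof. by rewrite [leRHS]mx_normrE; apply/bigmax_geP; right; exists (i, j). Qed.

Lemma mx_norm_le m n (x : 'M[R]_(m, n)) (e : R) : 0 <= e ->
  (forall i j, `|x i j| <= e) -> `|x| <= e.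
Proof. by move=> e0 H; rewrite [leLHS]mx_normrE; apply/bigmax_leP; split. Qed.

Lemma lip_at_mxP (V : normedModType R) m n (f : V -> 'M[R]_(m, n)) x :
  lip_at f x <-> forall i j, lip_at (fun y => f y i j : R^o) x.
Proof.
split => [[k Hk] i j|H].
  exists k; apply: filterS Hk => p; apply: le_trans.
  by have := mx_entry_norm (f p.1 - f p.2) i j; rewrite !mxE.
have {}H i j := lip_at_pos (H i j).
pose K := \sum_i \sum_j sval (cid2 (H i j)).
have K0 i j : 0 <= sval (cid2 (H i j)) by case: cid2.
exists K.
have near_all (I : finType) (F : I -> V * V -> Prop) :
    (forall i, \forall p \near (x, x), F i p) ->
    \forall p \near (x, x), forall i, F i p.
  move=> HF; have := @filter_forall _ _ F (nbhs (x, x)) _ HF; exact.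
have HK : \forall p \near (x, x), forall i j,
    `|f p.1 i j - f p.2 i j| <= sval (cid2 (H i j)) * `|p.1 - p.2|.
  apply: (near_all _ (fun i p => forall j, `|f p.1 i j - f p.2 i j| <=
    sval (cid2 (H i j)) * `|p.1 - p.2|)) => i.
  apply: (near_all _ (fun j p => `|f p.1 i j - f p.2 i j| <=
    sval (cid2 (H i j)) * `|p.1 - p.2|)) => j.
  by case: cid2.
apply: filterS HK => p hp; apply: mx_norm_le.
  apply: mulr_ge0 => //; apply: sumr_ge0 => i _.
  by apply: sumr_ge0 => j _; exact: K0.
move=> i j; rewrite !mxE; apply: le_trans (hp i j) _; rewrite ler_wpM2r//.
rewrite /K (bigD1 i)//= (bigD1 j)//= -addrA lerDl addr_ge0//.
  by apply: sumr_ge0 => j' _; exact: K0.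
by apply: sumr_ge0 => i' _; apply: sumr_ge0 => j' _; exact: K0.
Qed.

Lemma lip_at_det (V : normedModType R) n (f : V -> 'M[R]_n) x :
  lip_at f x -> lip_at (fun y => \det (f y) : R^o) x.
Proof.
move=> /lip_at_mxP lf; rewrite /determinant; apply: lip_at_sum => s.
apply: lip_atM; first exact: lip_at_cst.
exact: lip_at_prod.
Qed.

Lemma lip_at_mulmx (V : normedModType R) m n p (f : V -> 'M[R]_(m, n))
    (g : V -> 'M[R]_(n, p)) x :
  lip_at f x -> lip_at g x -> lip_at (fun y => f y *m g y) x.
Proof.
move=> /lip_at_mxP lf /lip_at_mxP lg; apply/lip_at_mxP => i j.
under eq_fun do rewrite mxE.
by apply: lip_at_sum => k; exact: lip_atM.
Qed.

Lemma jacobianE m n (f : 'rV[R]_m -> 'rV[R]_n) x v :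
  'd f x v = v *m jacobian f x.
Proof. by rewrite mul_rV_lin1. Qed.

Lemma diff_coord m n (M : 'M[R]_(m, n)) i j :
  'd (fun N : 'M[R]_(m, n) => N i j : R^o) M = (fun N => N i j) :> (_ -> _).
Proof.
have @f : {linear 'M[R]_(m, n) -> R^o}.
  by exists (fun N : 'M[R]_(_, _) => N i j); do 2![eexists]; do ?[constructor];
     rewrite ?mxE// => ? *; rewrite ?mxE//; move=> ?; rewrite !mxE.
rewrite (_ : (fun _ => _) = f)//; apply: diff_lin; exact: coord_continuous.
Qed.

(** For transition maps, whose Jacobians are locally Lipschitz by definition and
    thus locally bounded, this gives that they are locally Lipschitz themselves. *)
Lemma lip_at_jacobian m n (f : 'rV[R]_m -> 'rV[R]_n) x :
  (\forall y \near x, differentiable f y) -> lip_at (jacobian f) x -> lip_at f x.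
Proof.
move=> df lJ; have [k k0 Hk] := lip_at_bounded lJ.
apply/lip_at_mxP => i j; rewrite (ord1 i).
apply: (@lip_at_diff _ _ _ (m%:R * k)); apply: filterS2 df Hk => y df Hk.
have dc : differentiable (fun N : 'rV[R]_n => N ord0 j : R^o) (f y).
  exact: differentiable_coord.
have dfj : differentiable ((fun z : 'rV[R]_n => z ord0 j : R^o) \o f) y.
  exact: differentiable_comp.
split => // v.
have -> : 'd (fun y0 : 'rV[R]_m => f y0 ord0 j : R^o) y v = (v *m jacobian f y) ord0 j.
  by rewrite -jacobianE [LHS](congr1 (@^~ v) (diff_comp df dc)) /= diff_coord.
rewrite mxE; apply: le_trans (ler_norm_sum _ _ _) _.
rewrite -mulrA [leRHS]mulr_natl -[X in _ *+ X]card_ord -sumr_const.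
apply: ler_sum => l _; rewrite normrM mulrC ler_pM//.
  exact: le_trans (mx_entry_norm _ _ _) Hk.
exact: mx_entry_norm.
Qed.

End lipschitz_germs.

(** * Partial derivatives of continuous functions are Borel *)

Section partial_derivatives.
Context (R : realType) (n : nat).
Implicit Types (U : set 'rV[R]_n) (f g : 'rV[R]_n -> R).

Lemma near_dnbhs0_neq0 : \forall h \near (0:R)^', h != 0.
Proof. by rewrite near_withinE; apply: nearW. Qed.

Lemma delta_norm_le (i : 'I_n) : `|delta_mx ord0 i : 'rV[R]_n| <= 1.
Proof.
apply: mx_norm_le => // j k; rewrite mxE.
by case: (_ && _); rewrite ?normr1 ?normr0.
Qed.

Definition diff_quotient (i : 'I_n) f (h : R) (x : 'rV[R]_n) : R :=
  h^-1 * (f (h *: delta_mx ord0 i + x) - f x).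

Lemma pderivE i f x :
  pderiv i f x = lim (diff_quotient i f h x @[h --> (0:R)^'] : set_system R^o).
Proof. by []. Qed.

Lemma pderiv_cvg i f x : cvg (diff_quotient i f h x @[h --> (0:R)^'] : set_system R^o) ->
  diff_quotient i f h x @[h --> (0:R)^'] --> (pderiv i f x : R^o).
Proof. by []. Qed.

(** The limit of a function that does not converge is a default value. *)
Lemma pderiv_dvg i f x : ~ cvg (diff_quotient i f h x @[h --> (0:R)^'] : set_system R^o) ->
  pderiv i f x = (point : R^o).
Proof.
move=> nc; rewrite pderivE /lim /lim_in xgetPN// => l Hl.
by apply: nc; apply/cvg_ex; exists l.
Qed.

Lemma line_cvg i x (h : R) : (fun k : R^o => k *: delta_mx ord0 i + x) @ (h : R^o) -->
  (h *: delta_mx ord0 i + x : 'rV[R]_n).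
Proof.
apply: cvgD; last exact: cvg_cst.
by apply: cvgZr_tmp; exact: cvg_id.
Qed.

Lemma pderiv_bounded i f x : lip_at (f : _ -> R^o) x ->
  exists k, \forall y \near x, `|pderiv i f y| <= k.
Proof.
move=> /lip_at_pos[k k0 [[N1 N2] /= [xN1 xN2] HN]].
exists (Num.max k `|point : R^o|).
have /nbhs_interior xN : nbhs x (N1 `&` N2) by exact: filterI.
apply: filterS xN => y yN.
have [c|nc] := pselect
  (cvg (diff_quotient i f h y @[h --> (0:R)^'] : set_system R^o)); last first.
  by rewrite pderiv_dvg// le_max lexx orbT.
rewrite le_max; apply/orP; left.
have ch := cvg_norm (FF := dnbhs_filter _) (pderiv_cvg c).
rewrite -(cvg_lim _ ch)//; apply: limr_le; first exact: (cvgP _ ch).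
have yh : \forall h \near (0:R)^', (N1 `&` N2) (h *: delta_mx ord0 i + y).
  apply: nbhs_dnbhs.
  by have := @line_cvg i y 0; rewrite scale0r add0r; apply.
apply: filterS2 yh near_dnbhs0_neq0 => h [Nh _] h0.
have [_ Ny] := nbhs_singleton yN.
have /= := HN (_, y) (conj Nh Ny); rewrite addrK => hk.
rewrite /diff_quotient normrM normfV mulrC ler_pdivrMr ?normr_gt0//.
apply: le_trans hk _; rewrite ler_wpM2l// normrZ -[leRHS]mulr1.
by rewrite ler_wpM2l// delta_norm_le.
Qed.

Lemma measurable_translation (v : 'rV[R]_n) :
  measurable_fun setT (fun x : Rn R n => (v + (x : 'rV[R]_n) : Rn R n)).
Proof.
apply: (measurability (@open 'rV[R]_n : set (set (Rn R n)))) => //.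
move=> _ [V oV <-]; rewrite setTI; apply: open_measurable_Rn.
have ct : continuous (fun x : 'rV[R]_n => v + x).
  move=> x; apply: (@lip_at_continuous R 'rV[R]_n 'rV[R]_n (fun y => v + y)).
  by exists 1; near=> p; rewrite mul1r opprD addrACA subrr add0r.
by apply: open_comp oV => x _; exact: ct.
Unshelve. all: by end_near. Qed.

Lemma measurable_diff_quotient i f h : measurable_fun (setT : set (Rn R n)) f ->
  measurable_fun (setT : set (Rn R n)) (diff_quotient i f h).
Proof.
move=> mf; apply: measurable_funM; first exact: measurable_cst.
apply: measurable_funB => //.
by apply: (measurableT_comp mf); exact: measurable_translation.
Qed.

(** The Cauchy criterion for the difference quotients as h tends to 0, with h and
    the bounds restricted to countable sets so that it cuts out a Borel set. *)
Definition rational_cauchy i f (x : Rn R n) : Prop :=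
  forall k : nat, exists m : nat, forall rs : rat * rat,
    [/\ rs.1 != 0, rs.2 != 0, `|ratr rs.1 : R| < m.+1%:R^-1
      & `|ratr rs.2 : R| < m.+1%:R^-1] ->
    `|diff_quotient i f (ratr rs.1) x - diff_quotient i f (ratr rs.2) x| <= k.+1%:R^-1.

Lemma measurable_rational_cauchy i f : measurable_fun (setT : set (Rn R n)) f ->
  measurable (rational_cauchy i f : set (Rn R n)).
Proof.
move=> mf.
pose C k m (rs : rat * rat) : set (Rn R n) := [set x |
    [/\ rs.1 != 0, rs.2 != 0, `|ratr rs.1 : R| < m.+1%:R^-1
      & `|ratr rs.2 : R| < m.+1%:R^-1] ->
    `|diff_quotient i f (ratr rs.1) x - diff_quotient i f (ratr rs.2) x| <= k.+1%:R^-1].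
have -> : rational_cauchy i f = \bigcap_k \bigcup_m \bigcap_rs C k m rs.
  apply/seteqP; split => x /= H k.
    by move=> _; have [m Hm] := H k; exists m => // rs _; exact: Hm.
  by have [m _ Hm] := H k Logic.I; exists m => rs; exact: Hm.
apply: bigcapT_measurable => k; apply: bigcupT_measurable => m.
rewrite -[X in measurable X]setCK setC_bigcap; apply: measurableC.
apply: countable_bigcupT_measurable => // rs; apply: measurableC.
have [c|c] := pselect [/\ rs.1 != 0, rs.2 != 0, `|ratr rs.1 : R| < m.+1%:R^-1
      & `|ratr rs.2 : R| < m.+1%:R^-1]; last first.
  rewrite (_ : C k m rs = setT)//; apply/seteqP; split => // x _ /c [].
rewrite (_ : C k m rs = [set x |
    `|diff_quotient i f (ratr rs.1) x - diff_quotient i f (ratr rs.2) x|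
    <= k.+1%:R^-1]); last first.
  by apply/seteqP; split => x /= h; [exact: h|move=> _].
rewrite -[X in measurable X]setTI.
have mq : measurable_fun (setT : set (Rn R n)) (fun x =>
    `|diff_quotient i f (ratr rs.1) x - diff_quotient i f (ratr rs.2) x|).
  apply: measurableT_comp => //.
  by apply: measurable_funB; exact: measurable_diff_quotient.
have mc : measurable_fun (setT : set (Rn R n)) (fun=> k.+1%:R^-1 : R).
  exact: measurable_cst.
have := measurable_fun_ler mq mc.
by move/(_ measurableT [set true] I).
Qed.

Lemma cvg_rational_cauchy i f x :
  cvg (diff_quotient i f h x @[h --> (0:R)^'] : set_system R^o) -> rational_cauchy i f x.
Proof.
move=> /pderiv_cvg /cvgrPdist_le H k.
have k2 : 0 < (k.+1%:R^-1 / 2 : R) by rewrite divr_gt0.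
have /nbhs_ballP[e /= e0 He] := H _ k2.
have [m Hm] : exists m : nat, m.+1%:R^-1 < e.
  by exists (Num.trunc e^-1); rewrite invf_plt ?posrE// truncnS_gt.
exists m => -[r s] /= [r0 s0 rm sm].
have Hq (q : rat) : q != 0 -> `|ratr q : R| < m.+1%:R^-1 ->
    `|pderiv i f x - diff_quotient i f (ratr q) x| <= k.+1%:R^-1 / 2.
  move=> q0 qm; apply: He; last by rewrite fmorph_eq0.
  by rewrite -ball_normE/= sub0r normrN (lt_trans qm).
rewrite [leRHS]splitr.
have -> : diff_quotient i f (ratr r) x - diff_quotient i f (ratr s) x =
  (pderiv i f x - diff_quotient i f (ratr s) x) -
  (pderiv i f x - diff_quotient i f (ratr r) x).
  by ring.
by apply: le_trans (ler_normB _ _) _; rewrite lerD// Hq.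
Qed.

(** The difference quotient at x depends continuously on h when h is small and not
    zero, so that its values at rational h approximate all the others. *)
Lemma rational_cauchy_cvg i f U x : open U -> {in U, continuous (f : _ -> R^o)} ->
  U x -> rational_cauchy i f x ->
  cvg (diff_quotient i f h x @[h --> (0:R)^'] : set_system R^o).
Proof.
move=> oU cf Ux H.
apply/cauchy_cvgP; apply: cauchy_exP => e e0.
have [k ke] : exists k : nat, k.+1%:R^-1 < e / 2.
  by exists (Num.trunc (e / 2)^-1); rewrite invf_plt ?posrE ?divr_gt0// truncnS_gt.
have [m Hm] := H k.
have m0 : 0 < (m.+1%:R^-1 : R) by [].
have [r /andP[r0 rm]] : exists r : rat, 0 < (ratr r : R) < m.+1%:R^-1.
  by have /rat_in_itvoo[r] := m0; rewrite in_itv/= => ?; exists r.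
exists (diff_quotient i f (ratr r) x).
have yh : \forall h \near (0:R)^', U (h *: delta_mx ord0 i + x).
  apply: nbhs_dnbhs.
  have := @line_cvg i x 0; rewrite scale0r add0r; apply.
  exact: open_nbhs_nbhs.
have hm : \forall h \near (0:R)^', `|h : R| < m.+1%:R^-1.
  apply: nbhs_dnbhs; apply/nbhs_ballP; exists m.+1%:R^-1 => // h.
  by rewrite -ball_normE/= sub0r normrN.
apply: filterS3 yh hm near_dnbhs0_neq0 => h Uh hm h0.
have cq : {for h, continuous (fun k : R^o => diff_quotient i f k x : R^o)}.
  rewrite /diff_quotient /continuous_at; apply: cvgM.
    by apply: cvgV => //; exact: cvg_id.
  apply: cvgB; last exact: cvg_cst.
  apply: (continuous_comp (f := fun k : R^o => k *: delta_mx ord0 i + x)).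
    exact: line_cvg.
  by apply: cf; rewrite inE.
have e2 : 0 < e / 2 by rewrite divr_gt0.
have /cvgrPdist_lt/(_ _ e2) nq := cq.
have nm : \forall k \near (h : R^o), `|k : R| < m.+1%:R^-1.
  have : {for h, continuous (fun k : R^o => `|k| : R^o)} by exact: norm_continuous.
  by move=> /cvgr_lt; apply.
have n0 : \forall k \near (h : R^o), k != 0.
  apply/nbhs_ballP; exists `|h|; first by rewrite /= normr_gt0.
  move=> k' /=; rewrite -ball_normE/=; apply: contraTneq => ->.
  by rewrite subr0 ltxx.
have /nbhs_ballP[d /= d0 Hd] : \forall k \near (h : R^o),
    [/\ `|diff_quotient i f h x - diff_quotient i f k x| < e / 2,
        `|k : R| < m.+1%:R^-1 & k != 0].
  by apply: filterS3 nq nm n0 => k' ? ? ?; split.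
have [s Hs] : exists s : rat, ball (h : R^o) d (ratr s : R).
  have /rat_in_itvoo[s] : h - d < h + d by rewrite ltrD2l gtrN.
  rewrite in_itv/= => /andP[s1 s2]; exists s.
  by rewrite /ball/= ltr_distlC s1 s2.
have [qs sm s0] := Hd _ Hs.
have := Hm (r, s); rewrite /= => Hrs.
have {}Hrs : `|diff_quotient i f (ratr r) x - diff_quotient i f (ratr s) x| <= k.+1%:R^-1.
  apply: Hrs; split => //.
  - by apply: contraTneq r0 => ->; rewrite rmorph0 ltxx.
  - by rewrite fmorph_eq0 in s0.
  - by rewrite gtr0_norm.
rewrite -ball_normE/=.
rewrite -(subrKA (diff_quotient i f (ratr s) x)) [e]splitr.
apply: le_lt_trans (ler_normD _ _) _; rewrite ltrD//.
  exact: le_lt_trans Hrs ke.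
by rewrite distrC.
Qed.

Lemma cvg_harmonic_dnbhs : (m.+1%:R^-1 : R) @[m --> \oo] --> (0:R)^'.
Proof.
move=> A /= A0.
have : \forall m \near \oo, (harmonic m : R) != 0 -> A (harmonic m).
  exact: (@cvg_harmonic R _ A0).
apply: filterS => m; apply.
by rewrite /harmonic/= invr_eq0 pnatr_eq0.
Qed.

Lemma pderiv_near i f g x : (\forall y \near x, f y = g y) -> pderiv i f x = pderiv i g x.
Proof. exact: near_eq_derive. Qed.

(** On the Borel set where the derivative exists, it is the limit of the difference
    quotients at h = 1/(m+1); elsewhere it is constant. *)
Lemma measurable_pderiv i f U : open U -> {in U, continuous (f : _ -> R^o)} ->
  measurable_fun (U : set (Rn R n)) (pderiv i f).
Proof.
move=> oU cf; have mU : measurable (U : set (Rn R n)) by exact: open_measurable_Rn.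
(* extended by zero, f is measurable on the whole space and has the same
   germs at the points of U *)
have mg := (@measurable_restrictT _ _ (Rn R n) (measurableTypeR R) U f mU).1
  (measurable_continuous_Rn oU cf).
set g := (X in measurable_fun _ X) in mg.
have fg x : U x -> \forall y \near x, f y = g y.
  move=> Ux; have : nbhs x U by exact: open_nbhs_nbhs.
  by apply: filterS => y Uy; rewrite /g patchE mem_set.
have cg : {in U, continuous (g : _ -> R^o)}.
  move=> x /[dup] Ux; rewrite inE => /fg fgx.
  rewrite /continuous_at -(nbhs_singleton fgx) => B fB.
  have : \forall y \near x, B (f y) by exact: (cf x Ux B fB).
  move: fgx; apply: filterS2 => y fgy By.
  by rewrite /= -fgy.
suff : measurable_fun (U : set (Rn R n)) (pderiv i g).
  by apply: eq_measurable_fun => x; rewrite inE => /fg /(pderiv_near i).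
pose E := rational_cauchy i g.
have mE : measurable (E : set (Rn R n)) by exact: measurable_rational_cauchy.
rewrite -(setUIDK U E); apply/measurable_funU; [exact: measurableI|exact: measurableD|].
split.
  apply: (@measurable_fun_cvg _ (Rn R n) R (U `&` E)
    (fun m x => diff_quotient i g (m.+1%:R^-1) x) (pderiv i g)).
    by move=> m; apply: measurable_funTS; exact: measurable_diff_quotient.
  move=> x [Ux Ex]; have c := rational_cauchy_cvg oU cg Ux Ex.
  exact: (cvg_comp _ _ cvg_harmonic_dnbhs (pderiv_cvg c)).
apply: (eq_measurable_fun (cst (point : R^o))); last exact: measurable_cst.
move=> x; rewrite inE => -[Ux nEx]; rewrite pderiv_dvg//.
by move/cvg_rational_cauchy.
Qed.

End partial_derivatives.

(** * Sections supported in a chart *)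

Lemma row_jacobian (R : realType) m n (f : 'rV[R]_m -> 'rV[R]_n) x i :
  row i (jacobian f x) = 'd f x (delta_mx 0 i).
Proof. by rewrite rowE jacobianE. Qed.

Lemma near_jacobian (R : realType) m n (f g : 'rV[R]_m -> 'rV[R]_n) x :
  differentiable f x -> differentiable g x -> (\forall y \near x, f y = g y) ->
  jacobian f x = jacobian g x.
Proof.
move=> df dg fg; apply/row_matrixP => i.
apply: etrans (row_jacobian f x i) _; apply: etrans (esym (row_jacobian g x i)).
apply: etrans (esym (deriveE (delta_mx 0 i) df)) _.
apply: etrans (deriveE (delta_mx 0 i) dg).
exact: (near_eq_derive (delta_mx 0 i) fg).
Qed.

Lemma jacobian_comp (R : realType) m n p (f : 'rV[R]_m -> 'rV[R]_n)
    (g : 'rV[R]_n -> 'rV[R]_p) x :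
  differentiable f x -> differentiable g (f x) ->
  jacobian (g \o f) x = jacobian f x *m jacobian g (f x).
Proof.
move=> df dg; apply/row_matrixP => i.
rewrite row_mul (row_jacobian (g \o f)) (row_jacobian f) -jacobianE.
exact: (congr1 (@^~ _) (diff_comp df dg)).
Qed.

Lemma jacobian_id (R : realType) n (x : 'rV[R]_n) : jacobian id x = 1%:M.
Proof.
apply/row_matrixP => i; rewrite row_jacobian row1.
exact: (congr1 (@^~ (delta_mx 0 i)) (@diff_val _ _ _ _ _ id id (is_diff_id _))).
Qed.

Lemma det_neq0_mul1 (R : realType) n (J K : 'M[R]_n) : J *m K = 1%:M -> \det J != 0.
Proof.
move=> /(congr1 determinant); rewrite det_mulmx det1 => E.
by apply/eqP => J0; move/eqP: E; rewrite J0 mul0r eq_sym oner_eq0.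
Qed.

Section charts.
Context (R : realType) (n : nat) (M : topologicalType).
Variable A : set (chart R n M).
Hypothesis hM : C11_manifold A.
Implicit Types (c d e : chart R n M) (p : M) (x : 'rV[R]_n).

Lemma cinv_cdom c x : cimg c x -> cdom c (cinv c x).
Proof. by move=> [p cp <-]; rewrite cmapK// inE. Qed.

Lemma cinv_cimgK c x : cimg c x -> cmap c (cinv c x) = x.
Proof. by move=> [p cp <-]; rewrite cmapK// inE. Qed.

Lemma cmap_cimg c p : cdom c p -> cimg c (cmap c p).
Proof. by move=> cp; exists p. Qed.

Lemma cmap_cdomK c p : cdom c p -> cinv c (cmap c p) = p.
Proof. by move=> cp; rewrite cmapK// inE. Qed.

Lemma cimg_nbhs c x : cimg c x -> nbhs x (cimg c).
Proof. by move=> cx; apply: open_nbhs_nbhs; split => //; exact: cimg_open. Qed.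

Lemma cdom_nbhs c p : cdom c p -> nbhs p (cdom c).
Proof. by move=> cx; apply: open_nbhs_nbhs; split => //; exact: cdom_open. Qed.

Lemma measurable_cimg c : measurable (cimg c : set (Rn R n)).
Proof. by apply: open_measurable_Rn; exact: cimg_open. Qed.

Lemma cinv_cvg c x : cimg c x -> cinv c @ x --> cinv c x.
Proof. by move=> cx; apply: cinv_continuous; rewrite inE. Qed.

Lemma cmap_cvg c p : cdom c p -> cmap c @ p --> cmap c p.
Proof. by move=> cx; apply: cmap_continuous; rewrite inE. Qed.

Lemma overlapE c d x : overlap c d x <-> cimg c x /\ cdom d (cinv c x).
Proof.
split => [[p [cp dp] <-]|[cx dx]].
  by rewrite cmap_cdomK//; split => //; exact: cmap_cimg.
by exists (cinv c x); [split => //; exact: cinv_cdom|exact: cinv_cimgK].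
Qed.

Lemma overlap_nbhs c d x : overlap c d x -> nbhs x (overlap c d).
Proof.
move=> /overlapE[cx dx]; apply: filterS2 (cimg_nbhs cx) (cinv_cvg cx (cdom_nbhs dx)).
by move=> y cy dy; apply/overlapE.
Qed.

Lemma overlap_open c d : open (overlap c d).
Proof. by rewrite openE => x /overlap_nbhs. Qed.

Lemma overlap_cmap c d p : cdom c p -> cdom d p -> overlap c d (cmap c p).
Proof. by move=> cp dp; exists p. Qed.

Lemma transition_diff c d : A c -> A d ->
  forall x, overlap c d x -> differentiable (transition c d) x.
Proof. by move=> Ac Ad x; have [h _] := C11_compatible hM Ac Ad; exact: h. Qed.

Lemma lip_at_transition_jacobian c d : A c -> A d ->
  forall x, overlap c d x -> lip_at (jacobian (transition c d)) x.
Proof.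
move=> Ac Ad x; have [_ h] := C11_compatible hM Ac Ad.
exact: ((loc_lipschitzP _ (@overlap_open c d)).1 h).
Qed.

Lemma lip_at_transition c d : A c -> A d ->
  forall x, overlap c d x -> lip_at (transition c d) x.
Proof.
move=> Ac Ad x cdx; apply: lip_at_jacobian; last exact: lip_at_transition_jacobian.
by apply: filterS (overlap_nbhs cdx) => y; exact: transition_diff.
Qed.

Lemma transition_cmap c d p : cdom c p -> transition c d (cmap c p) = cmap d p.
Proof. by move=> cp; rewrite /transition/= cmap_cdomK. Qed.

(** The chain rule, transition c e and the composite of the two other transition
    maps having the same germ at the point. *)
Lemma jacobian_cocycle c d e p : A c -> A d -> A e ->
  cdom c p -> cdom d p -> cdom e p ->
  jacobian (transition c e) (cmap c p) =
  jacobian (transition c d) (cmap c p) *m jacobian (transition d e) (cmap d p).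
Proof.
move=> Ac Ad Ae cp dp ep.
have dcd := transition_diff Ac Ad (overlap_cmap cp dp).
have dde := transition_diff Ad Ae (overlap_cmap dp ep).
have dce := transition_diff Ac Ae (overlap_cmap cp ep).
rewrite -(transition_cmap d cp) in dde *.
apply: etrans (jacobian_comp dcd dde).
apply: near_jacobian dce (differentiable_comp dcd dde) _.
apply: filterS (overlap_nbhs (overlap_cmap cp dp)) => y /overlapE[cy dy].
by rewrite /transition/= cmap_cdomK.
Qed.

Lemma jacobian_transition_id c p : A c -> cdom c p ->
  jacobian (transition c c) (cmap c p) = 1%:M.
Proof.
move=> Ac cp; rewrite -(jacobian_id (cmap c p)); apply: near_jacobian.
- exact: (transition_diff Ac Ac (overlap_cmap cp cp)).
- exact: (@ex_diff _ _ _ _ _ id id (is_diff_id _)).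
by apply: filterS (cimg_nbhs (cmap_cimg cp)) => y cy; rewrite /transition/= cinv_cimgK.
Qed.

Lemma det_transition_neq0 c d p : A c -> A d -> cdom c p -> cdom d p ->
  \det (jacobian (transition c d) (cmap c p)) != 0.
Proof.
move=> Ac Ad cp dp; apply: det_neq0_mul1.
exact: etrans (esym (jacobian_cocycle Ac Ad Ac cp dp cp)) (jacobian_transition_id Ac cp).
Qed.

Section chart_section.
Variables (c : chart R n M) (w : R) (u : 'rV[R]_n -> 'rV[R]_n) (L : set 'rV[R]_n).
Hypotheses (Ac : A c) (cL : compact L) (Lc : L `<=` cimg c).
Hypothesis u_lip : forall x, cimg c x -> lip_at u x.
Hypothesis u0 : forall x, ~ L x -> u x = 0.

Lemma compact_cinv : compact (cinv c @` L).
Proof.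
apply: continuous_compact cL; apply: continuous_in_subspaceT => x.
by rewrite inE => /Lc cx; exact: cinv_cvg.
Qed.

Lemma notin_cinv p : ~ (cinv c @` L) p -> \forall q \near p, ~ (cinv c @` L) q.
Proof.
move=> Lp; have := compact_closed (C11_hausdorff hM) compact_cinv.
by rewrite -openC openE => /(_ p Lp).
Qed.

(** The extension by zero of the section whose components in the chart c are u; in
    another chart d they are given by the transformation rule for weight w. *)
Definition chart_section : section R n M := fun d p =>
  if `[< [/\ A d, cdom d p & cdom c p] >] then
    let J := jacobian (transition c d) (cmap c p) in
    `|\det J| `^ (- w) *: (u (cmap c p) *m J)
  else 0.

Lemma chart_sectionE d p : A d -> cdom d p -> cdom c p ->
  chart_section d p = let J := jacobian (transition c d) (cmap c p) in
    `|\det J| `^ (- w) *: (u (cmap c p) *m J).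
Proof. by move=> Ad dp cp; rewrite /chart_section asboolT. Qed.

Lemma chart_section_out d p : ~ (cinv c @` L) p -> chart_section d p = 0.
Proof.
move=> Lp; rewrite /chart_section; case: ifPn => // /asboolP[Ad dp cp].
rewrite u0 ?mul0mx ?scaler0// => Lcp; apply: Lp.
by exists (cmap c p) => //; rewrite cmap_cdomK.
Qed.

Lemma chart_section_home p : cdom c p -> chart_section c p = u (cmap c p).
Proof.
move=> cp; rewrite chart_sectionE// (jacobian_transition_id Ac cp).
by rewrite /= det1 normr1 powR1 scale1r mulmx1.
Qed.

(** The transformation rule follows from the cocycle property of the Jacobians and
    the multiplicativity of the determinant. *)
Lemma is_section_chart_section : is_section A w chart_section.
Proof.
split=> [d p ndp|d e p Ad Ae dp ep J].
  by rewrite /chart_section; case: ifPn => // /asboolP[Ad dp _]; case: ndp.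
have [cp|ncp] := pselect (cdom c p); last first.
  by rewrite /chart_section !asboolF ?mul0mx ?scaler0//; case.
rewrite (chart_sectionE Ae ep cp) (chart_sectionE Ad dp cp).
rewrite (jacobian_cocycle Ac Ad Ae cp dp ep) -/J.
move: J (jacobian _ _) => J K /=.
rewrite det_mulmx normrM powRM// mulmxA -scalemxAl scalerA.
by rewrite [in RHS]mulrC.
Qed.

(** At a point outside the domain of c the section vanishes in a neighbourhood, as
    the support is compact and so closed in the Hausdorff space M.  At other points, its
    components are built from u, a transition map, a Jacobian and a power of a nonzero
    determinant, all of which are locally Lipschitz. *)
Lemma lipschitz_chart_section : lipschitz_section A w chart_section.
Proof.
split; first exact: is_section_chart_section.
move=> d i Ad; apply/loc_lipschitzP; first exact: cimg_open.
move=> x dx; have [cx|ncx] := pselect (cdom c (cinv d x)); last first.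
  have Lx : ~ (cinv c @` L) (cinv d x).
    by move=> [y /Lc cy yx]; apply: ncx; rewrite -yx; exact: cinv_cdom.
  apply: (@lip_at_near _ _ _ (fun=> 0 : R^o)); last exact: lip_at_cst.
  have nL : \forall y \near x, ~ (cinv c @` L) (cinv d y).
    exact: (cinv_cvg dx (notin_cinv Lx)).
  apply: filterS nL => y Ly.
  by rewrite /coord_fun chart_section_out// mxE.
have ox : overlap d c x by apply/overlapE.
have ox' : overlap c d (transition d c x).
  by apply: overlap_cmap => //; exact: cinv_cdom.
pose J y := jacobian (transition c d) (transition d c y).
apply: (@lip_at_near _ _ _ (fun y =>
    `|\det (J y)| `^ (- w) * (u (transition d c y) *m J y) ord0 i : R^o)).
  apply: filterS (overlap_nbhs ox) => y /overlapE[dy cy].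
  by rewrite /coord_fun chart_sectionE ?mxE//; exact: cinv_cdom.
have lt := lip_at_transition Ad Ac ox.
have lJ : lip_at J x.
  apply: lip_at_comp lt _; exact: lip_at_transition_jacobian.
apply: lip_atM.
  apply: (@lip_at_comp _ _ _ _ (fun y => `|\det (J y)| : R^o)
    (fun r : R^o => r `^ (- w) : R^o)).
    by apply: lip_at_norm; exact: lip_at_det.
  apply: lip_at_powR; rewrite normr_gt0; apply: det_transition_neq0 => //.
  exact: cinv_cdom.
have : lip_at (fun y => u (transition d c y) *m J y) x.
  apply: lip_at_mulmx lJ; apply: lip_at_comp lt _; apply: u_lip.
  exact: cmap_cimg.
by move=> /lip_at_mxP/(_ ord0 i).
Qed.

Lemma vanishes_off_chart_section : vanishes_off (cinv c @` L) chart_section.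
Proof. by move=> d p Lp; exact: chart_section_out. Qed.

End chart_section.
End charts.

(** * The algebra of the integrand *)

Section quadratic_form.
Context (R : numFieldType) (n : nat).
Variable g : 'I_n -> 'I_n -> 'I_n -> R.
Hypothesis g_sym : forall k j i, g k j i = g k i j.
Implicit Types (v w : 'I_n -> R) (p q : 'I_n -> 'I_n -> R).

(** The trace a_i by which nabla acts on densities. *)
Definition christoffel_trace (i : 'I_n) : R := \sum_k g k k i.

(** The part of order zero of the derivative nabla_i of the half-density v^j. *)
Definition zeroth_part v (i j : 'I_n) : R :=
  \sum_k g j k i * v k - 2^-1 * christoffel_trace i * v j.

(** The form [p, q] = tr p tr q - tr (p q). *)
Definition trace_form p q : R := \sum_i \sum_j (p i i * q j j - p i j * q j i).

(** The part of the Ricci tensor that is quadratic in the Christoffel symbols. *)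
Definition ricci_quad (k l : 'I_n) : R :=
  \sum_i \sum_j (g i k l * g j j i - g j k i * g i l j).

Lemma trace_formD p p' q q' :
  trace_form (fun i j => p i j + p' i j) (fun i j => q i j + q' i j) =
  trace_form p q + trace_form p q' + trace_form p' q + trace_form p' q'.
Proof.
rewrite /trace_form -!big_split; apply: eq_bigr => i _.
by rewrite -!big_split; apply: eq_bigr => j _ /=; ring.
Qed.

Lemma trace_formE p q : trace_form p q =
  (\sum_i p i i) * (\sum_j q j j) - \sum_i \sum_j p i j * q j i.
Proof.
rewrite /trace_form mulr_suml -sumrB; apply: eq_bigr => i _.
by rewrite mulr_sumr -sumrB.
Qed.

Lemma trace_formC p q : trace_form p q = trace_form q p.
Proof.
rewrite /trace_form exchange_big; apply: eq_bigr => i _; apply: eq_bigr => j _.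
by rewrite mulrC [p j i * _]mulrC.
Qed.

Lemma trace_form0 p : trace_form p (fun _ _ => 0) = 0.
Proof.
rewrite /trace_form big1// => i _; rewrite big1// => j _.
by rewrite !mulr0 subrr.
Qed.

(** Of the two traces, the first equals sum_k a_k v^k by the symmetry of g, and the
    weight 1/2 removes half of it. *)
Lemma zeroth_part_trace v :
  \sum_i zeroth_part v i i = 2^-1 * \sum_k christoffel_trace k * v k.
Proof.
rewrite /zeroth_part sumrB exchange_big/=.
rewrite (eq_bigr (fun k => christoffel_trace k * v k)); last first.
  by move=> k _; rewrite -mulr_suml; congr (_ * _); apply: eq_bigr => i _.
under [X in _ - X]eq_bigr do rewrite -mulrA.
by rewrite -mulr_sumr; field.
Qed.

Lemma zeroth_part_trace_mul v w :
  \sum_i \sum_j zeroth_part v i j * zeroth_part w j i =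
  (2^-1 * \sum_k christoffel_trace k * v k) * (2^-1 * \sum_k christoffel_trace k * w k)
  - \sum_k \sum_l v k * w l * ricci_quad k l.
Proof.
(* X and Y come from the two products in [ricci_quad] *)
pose S u i j := \sum_k g j k i * u k.
pose X := \sum_k \sum_l v k * w l * \sum_i g i k l * christoffel_trace i.
pose Y := \sum_k \sum_l v k * w l * \sum_i \sum_j g j k i * g i l j.
have SS : \sum_i \sum_j S v i j * S w j i = Y.
  transitivity (\sum_i \sum_k \sum_l \sum_j (v k * w l) * (g j k i * g i l j)).
    apply: eq_bigr => i _;
    transitivity (\sum_j \sum_k \sum_l v k * w l * (g j k i * g i l j)).
      apply: eq_bigr => j _; rewrite big_distrlr/=.
      by apply: eq_bigr => k _; apply: eq_bigr => l _; ring.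
    by rewrite exchange_big; apply: eq_bigr => k _; rewrite exchange_big.
  rewrite exchange_big; apply: eq_bigr => k _.
  rewrite exchange_big; apply: eq_bigr => l _.
  rewrite mulr_sumr; apply: eq_bigr => i _.
  by rewrite mulr_sumr.
have X1 : \sum_i \sum_j S v i j * (christoffel_trace j * w i) = X.
  transitivity (\sum_l \sum_k \sum_i v k * w l * (g i k l * christoffel_trace i)).
    apply: eq_bigr => l _; rewrite exchange_big; apply: eq_bigr => i _.
    by rewrite mulr_suml; apply: eq_bigr => k _; ring.
  rewrite exchange_big; apply: eq_bigr => k _; apply: eq_bigr => l _.
  by rewrite mulr_sumr.
have X2 : \sum_i \sum_j christoffel_trace i * v j * S w j i = X.
  rewrite exchange_big; apply: eq_bigr => k _.
  transitivity (\sum_i \sum_l v k * w l * (g i k l * christoffel_trace i)).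
    apply: eq_bigr => i _; rewrite mulr_sumr; apply: eq_bigr => l _.
    by rewrite (g_sym i l k); ring.
  rewrite exchange_big; apply: eq_bigr => l _.
  by rewrite mulr_sumr.
have ricciE : \sum_k \sum_l v k * w l * ricci_quad k l = X - Y.
  rewrite /X /Y -sumrB; apply: eq_bigr => k _; rewrite -sumrB.
  apply: eq_bigr => l _; rewrite -mulrBr -sumrB; congr (_ * _).
  apply: eq_bigr => i _; rewrite sumrB; congr (_ - _).
  by rewrite mulr_sumr.
have AA : \sum_i \sum_j (christoffel_trace i * w i) * (christoffel_trace j * v j) =
    (\sum_k christoffel_trace k * v k) * (\sum_k christoffel_trace k * w k).
  by rewrite mulrC big_distrlr.
have -> : \sum_i \sum_j zeroth_part v i j * zeroth_part w j i =
    \sum_i \sum_j S v i j * S w j i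
    - 2^-1 * (\sum_i \sum_j S v i j * (christoffel_trace j * w i))
    - 2^-1 * (\sum_i \sum_j christoffel_trace i * v j * S w j i)
    + 2^-1 * 2^-1 * \sum_i \sum_j (christoffel_trace i * w i) * (christoffel_trace j * v j).
  rewrite !mulr_sumr -!sumrB -big_split; apply: eq_bigr => i _ /=.
  rewrite !mulr_sumr -!sumrB -big_split; apply: eq_bigr => j _ /=.
  by rewrite /zeroth_part -/(S v i j) -/(S w j i); ring.
by rewrite SS X1 X2 AA ricciE; field.
Qed.

(** The products of two traces cancel between tr B(v) tr B(w) and tr (B(v) B(w)). *)
Lemma trace_form_zeroth_part v w :
  trace_form (zeroth_part v) (zeroth_part w) = \sum_k \sum_l v k * w l * ricci_quad k l.
Proof.
rewrite trace_formE !zeroth_part_trace zeroth_part_trace_mul opprB.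
by rewrite addrCA subrr addr0.
Qed.

(** The value of [dv, B(w)] for v = x^p e_k and w = e_l. *)
Definition mixed (p k l : 'I_n) : R :=
  2^-1 * ((k == p)%:R * christoffel_trace l) +
  2^-1 * ((l == p)%:R * christoffel_trace k) - g p l k.

Lemma zeroth_part_delta (l i j : 'I_n) :
  zeroth_part (fun m => (m == l)%:R) i j =
  g j l i - 2^-1 * christoffel_trace i * (j == l)%:R.
Proof.
rewrite /zeroth_part (bigD1 l)//= eqxx mulr1 big1 ?addr0// => k /negbTE ->.
by rewrite mulr0.
Qed.

Lemma trace_form_mixed (p k l : 'I_n) :
  trace_form (fun i j => (i == p)%:R * (j == k)%:R) (zeroth_part (fun m => (m == l)%:R)) =
  mixed p k l.
Proof.
rewrite trace_formE zeroth_part_trace.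
have -> : \sum_i (i == p)%:R * (i == k)%:R = (k == p)%:R :> R.
  rewrite (bigD1 k)//= eqxx mulr1 big1 ?addr0// => i /negbTE ->.
  by rewrite mulr0.
have -> : \sum_i christoffel_trace i * (i == l)%:R = christoffel_trace l.
  rewrite (bigD1 l)//= eqxx mulr1 big1 ?addr0// => i /negbTE ->.
  by rewrite mulr0.
have -> : \sum_i \sum_j (i == p)%:R * (j == k)%:R *
    zeroth_part (fun m => (m == l)%:R) j i =
    g p l k - 2^-1 * christoffel_trace k * (p == l)%:R.
  rewrite (bigD1 p)//= [X in _ + X]big1 ?addr0; last first.
    by move=> i /negbTE ->; rewrite big1// => j _; rewrite !mul0r.
  rewrite (bigD1 k)//= [X in _ + X]big1 ?addr0; last first.
    by move=> i /negbTE ->; rewrite mulr0 mul0r.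
  by rewrite !eqxx !mul1r zeroth_part_delta.
by rewrite /mixed (eq_sym p l); ring.
Qed.

(** This contraction is where the dimension must differ from 1. *)
Lemma mixed_trace l : \sum_k mixed k k l = 2^-1 * (n%:R - 1) * christoffel_trace l.
Proof.
rewrite /mixed sumrB big_split/=.
under eq_bigr do rewrite eqxx mul1r.
rewrite sumr_const card_ord.
rewrite (bigD1 l)//= [X in _ + (_ + X) - _]big1 ?addr0; last first.
  by move=> k /negbTE; rewrite eq_sym => ->; rewrite mul0r mulr0.
under [X in _ - X]eq_bigr do rewrite g_sym.
by rewrite -/(christoffel_trace l) eqxx mul1r -mulr_natl; field.
Qed.

End quadratic_form.

(** * Test fields *)

Section bump_function.
Context (R : realType) (n : nat).
Implicit Types (x y : 'rV[R]_n).

(** The function equal to 1 for |y - x| <= r, to 0 for |y - x| >= 2 r and affine in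
    |y - x| in between: (|t| - |t - 1| + 1) / 2 is the truncation of t to [0, 1], written
    with norms only so that it is visibly Lipschitz. *)
Definition bump x (r : R) y : R :=
  let t := 2 - `|y - x| / r in (`|t| - `|t - 1| + 1) / 2.

Lemma bump1 x r y : 0 < r -> `|y - x| <= r -> bump x r y = 1.
Proof.
move=> r0 yx; have t1 : 1 <= 2 - `|y - x| / r.
  by rewrite lerBrDl -lerBrDr ler_pdivrMr// (le_trans yx)//; lra.
rewrite /bump/= ger0_norm ?(le_trans ler01)// ger0_norm ?subr_ge0//; lra.
Qed.

Lemma bump0 x r y : 0 < r -> 2 * r <= `|y - x| -> bump x r y = 0.
Proof.
move=> r0 yx; have t0 : 2 - `|y - x| / r <= 0.
  by rewrite subr_le0 ler_pdivlMr.
rewrite /bump/= ler0_norm// ler0_norm; lra.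
Qed.

Lemma bump_ge0 x r y : 0 <= bump x r y.
Proof.
rewrite /bump/=; set t := 2 - _.
have : `|t - 1| <= `|t| + 1 by rewrite (le_trans (ler_normB _ _))// normr1.
by move=> h; rewrite divr_ge0//; lra.
Qed.

Lemma lip_at_bump x r y : lip_at (bump x r : _ -> R^o) y.
Proof.
have l1 : lip_at (fun z : 'rV[R]_n => `|z - x| : R^o) y.
  exists 1; near=> p; rewrite mul1r; apply: le_trans (ler_dist_dist _ _) _.
  by rewrite opprB addrA subrK.
have lt : lip_at (fun z : 'rV[R]_n => 2 - `|z - x| / r : R^o) y.
  apply: (@lip_at_near _ _ _ (fun z => 2 + (- r^-1) * `|z - x| : R^o)).
    by near=> z; rewrite mulNr mulrC.
  by apply: lip_atD; [exact: lip_at_cst|apply: lip_atM => //; exact: lip_at_cst].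
apply: (@lip_at_near _ _ _ (fun z : 'rV[R]_n => (`|2 - `|z - x| / r| +
   (-1) * `|2 - `|z - x| / r + (-1)| + 1) * 2^-1 : R^o)).
  by near=> z; rewrite mulN1r.
apply: lip_atM; last exact: lip_at_cst.
apply: lip_atD; last exact: lip_at_cst.
apply: lip_atD; first exact: lip_at_norm.
apply: lip_atM; first exact: lip_at_cst.
by apply: lip_at_norm; apply: lip_atD => //; exact: lip_at_cst.
Unshelve. all: by end_near. Qed.

End bump_function.

Section test_fields.
Context (R : realType) (n : nat) (M : topologicalType).
Variable A : set (chart R n M).
Hypothesis hM : C11_manifold A.
Variables (c : chart R n M) (x0 : 'rV[R]_n) (r : R).
Hypotheses (Ac : A c) (r0 : 0 < r).

Section test_section.
Hypothesis rc : closed_ball x0 (2 * r) `<=` cimg c.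
Variables (w : R) (a : 'rV[R]_n -> R) (k : 'I_n).
Hypothesis a_lip : forall x, lip_at (a : _ -> R^o) x.

Let u x : 'rV[R]_n := (bump x0 r x * a x) *: delta_mx ord0 k.

Let L := closed_ball x0 (2 * r).

Let r20 : 0 < 2 * r. Proof. by rewrite mulr_gt0. Qed.

(** The section with components a e_k on the ball of radius r, cut off by a bump
    function supported in the ball of radius 2 r. *)
Definition test_section : section R n M := chart_section A c w u.

Let u_lip x : lip_at u x.
Proof.
apply/lip_at_mxP => i j; apply: (@lip_at_near _ _ _ (fun y =>
    bump x0 r y * a y * (delta_mx ord0 k : 'rV[R]_n) i j : R^o)).
  by near=> y; rewrite [RHS]mxE.
apply: lip_atM; last exact: lip_at_cst.
by apply: lip_atM => //; exact: lip_at_bump.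
Unshelve. all: by end_near. Qed.

Let u0 x : ~ L x -> u x = 0.
Proof.
rewrite /L closed_ballE// /closed_ball_ /= => xL.
rewrite /u bump0// ?mul0r ?scale0r// distrC leNgt; apply/negP => h.
by apply: xL; exact: ltW.
Qed.

Lemma test_section_lipschitz : lipschitz_section A w test_section.
Proof.
apply: (@lipschitz_chart_section _ _ _ _ hM c w u L) => //.
exact: compact_closed_ball_Rn.
Qed.

Lemma test_section_vanishes_off : vanishes_off (cinv c @` L) test_section.
Proof. exact: vanishes_off_chart_section. Qed.

Lemma test_section_home p : cdom c p -> ball x0 r (cmap c p) ->
  test_section c p = a (cmap c p) *: delta_mx ord0 k.
Proof.
move=> cp; rewrite -ball_normE/= => h.
rewrite /test_section (chart_section_home hM)// /u bump1 ?mul1r// distrC.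
exact: ltW.
Qed.

Lemma ball_cimg x : ball x0 r x -> cimg c x.
Proof.
move=> h; apply: rc; apply: subset_closed_ball; apply: le_ball h.
by rewrite ler_peMl ?ler1n// ltW.
Qed.

Lemma coord_test_section j x : ball x0 r x ->
  coord_fun test_section c j x = a x * (j == k)%:R.
Proof.
move=> x0x; have cx := ball_cimg x0x.
rewrite /coord_fun test_section_home ?cinv_cimgK ?mxE//; exact: cinv_cdom.
Qed.

Lemma pderiv_test_section i j x : ball x0 r x ->
  pderiv i (coord_fun test_section c j) x = pderiv i a x * (j == k)%:R.
Proof.
move=> x0x; have nx : \forall y \near x, ball x0 r y.
  by apply: open_nbhs_nbhs; split => //; exact: ball_open.
have [jk|jk] := eqVneq j k.
  rewrite mulr1; apply: pderiv_near; apply: filterS nx => y /coord_test_section ->.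
  by rewrite jk eqxx mulr1.
rewrite mulr0 (@pderiv_near _ _ _ _ (cst 0)); first exact: derive_cst.
by apply: filterS nx => y /coord_test_section ->; rewrite (negbTE jk) mulr0.
Qed.

End test_section.

Hypothesis rc : closed_ball x0 (2 * (2 * r)) `<=` cimg c.

(** Equal to 1 on the support of the test sections, so that it forms by itself a
    partition of unity on this support. *)
Definition cutoff (p : M) : R :=
  if `[< cdom c p >] then bump x0 (2 * r) (cmap c p) else 0.

Lemma cutoff_partition :
  partition_of_unity_on A (cinv c @` closed_ball x0 (2 * r)) (fun _ : 'I_1 => c)
    (fun _ : 'I_1 => cutoff).
Proof.
have r20 : 0 < 2 * r by rewrite mulr_gt0.
have r40 : 0 < 2 * (2 * r) by rewrite mulr_gt0.
have cL := @compact_closed_ball_Rn _ _ x0 _ r40.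
have out p : ~ (cinv c @` closed_ball x0 (2 * (2 * r))) p -> cutoff p = 0.
  move=> Lp; rewrite /cutoff; case: ifPn => // /asboolP cp.
  rewrite bump0// leNgt distrC; apply/negP => h; apply: Lp.
  exists (cmap c p); last exact: cmap_cdomK.
  by rewrite closed_ballE// /closed_ball_/= ltW.
split => //.
- move=> _ p; have [cp|ncp] := pselect (cdom c p).
    have np : \forall q \near p, bump x0 (2 * r) (cmap c q) = cutoff q.
      by apply: filterS (cdom_nbhs cp) => q cq; rewrite /cutoff asboolT.
    have cb : {for p, continuous (fun q => bump x0 (2 * r) (cmap c q) : R^o)}.
      apply: continuous_comp; first exact: cmap_cvg.
      by apply: lip_at_continuous; exact: lip_at_bump.
    move=> B; rewrite -(nbhs_singleton np) => /cb.
    by move: np; apply: filterS2 => q /= ->.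
  have Lp : ~ (cinv c @` closed_ball x0 (2 * (2 * r))) p.
    by move=> [x /rc cx xp]; apply: ncp; rewrite -xp; exact: cinv_cdom.
  have np := notin_cinv hM cL rc Lp.
  move=> B; rewrite (out p Lp) => B0; apply: filterS np => q /out /= ->.
  exact: nbhs_singleton.
- by move=> _ p; rewrite /cutoff; case: ifP => // _; exact: bump_ge0.
- move=> _; exists (cinv c @` closed_ball x0 (2 * (2 * r))); split => //.
    exact: compact_cinv.
  by move=> _ [x /rc cx <-]; exact: cinv_cdom.
- move=> _ [x Kx <-]; rewrite big_ord1 /cutoff asboolT.
    have cx : cimg c x.
      apply: rc; move: x Kx; apply: le_closed_ball.
      by rewrite ler_peMl ?ler1n// ltW.
    rewrite cinv_cimgK// bump1// distrC.
    by move: Kx; rewrite closed_ballE.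
  apply: cinv_cdom; apply: rc; move: x Kx; apply: le_closed_ball.
  by rewrite ler_peMl ?ler1n// ltW.
Qed.

Lemma cutoff1 x : ball x0 r x -> cutoff (cinv c x) = 1.
Proof.
move=> x0x; have cx : cimg c x.
  apply: rc; apply: subset_closed_ball; apply: le_ball x0x.
  by rewrite mulrA ler_peMl ?ltW//; lra.
rewrite /cutoff asboolT; last exact: cinv_cdom.
rewrite cinv_cimgK// bump1 ?mulr_gt0// distrC; move: x0x; rewrite -ball_normE/= => /ltW.
by move/le_trans; apply; rewrite ler_peMl ?ler1n// ltW.
Qed.

End test_fields.

(** * The Christoffel symbols and the integrand of Q *)

Section christoffel.
Context (R : realType) (n : nat) (M : topologicalType).
Variable A : set (chart R n M).
Hypothesis hM : C11_manifold A.
Variable D : section R n M -> section R n M -> section R n M.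
Hypothesis hD : measurable_torsion_free_connection A D.
Variables (c : chart R n M) (G : 'I_n -> 'I_n -> 'I_n -> 'rV[R]_n -> R).
Hypotheses (Ac : A c) (hG : is_christoffel A D c G).
Local Notation mu := (@lebesgue_Rn R n).

Lemma ae_forall (I : finType) (P : I -> 'rV[R]_n -> Prop) :
  (forall i, {ae mu, forall x, P i x}) -> {ae mu, forall x, forall i, P i x}.
Proof.
move=> HP; have : {ae mu, forall x, forall i, i \in enum I -> P i x}.
  elim: (enum I) => [|a s IH]; first by apply: aeW.
  apply: ae_imp (ae_and (HP a) IH) => x [Pa Ps] i.
  by rewrite inE => /predU1P[->//|/Ps].
by apply: ae_imp => x H i; apply: H; rewrite mem_enum.
Qed.

(** The radii r, 2 r and 4 r are those of the ball where test sections have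
    prescribed components, of their support and of the support of the cutoff. *)
Lemma cimg_closed_ball x : cimg c x ->
  exists2 r, 0 < r & closed_ball x (2 * (2 * r)) `<=` cimg c.
Proof.
move=> cx; have [e e0 ec] := open_closed_ball (cimg_nbhs cx).
exists (e / 4); first by rewrite divr_gt0.
by rewrite [2 * _](_ : _ = e)//; field.
Qed.

(** Near each point there are Lipschitz vector fields that agree with the
    coordinate fields; their Lie bracket vanishes there, so that they commute under
    the torsion-free connection. *)
Lemma christoffel_sym :
  {ae mu, forall x, cimg c x -> forall k j i, G k j i x = G k i j x}.
Proof.
apply: ae_local => x0 /cimg_closed_ball[r r0 rc].
have {}rc : closed_ball x0 (2 * r) `<=` cimg c.
  apply: subset_trans rc; apply: le_closed_ball.
  by rewrite ler_peMl ?ler1n// mulr_ge0// ltW.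
exists (ball x0 r); first exact: nbhsx_ballx.
have a1 (x : 'rV[R]_n) : lip_at (fun=> 1 : R^o) x by exact: lip_at_cst.
pose X k := test_section A c x0 r 0 (fun=> 1) k.
have XL k : lipschitz_vector_field A (X k) by exact: test_section_lipschitz.
pose O : set M := cdom c `&` cmap c @^-1` ball x0 r.
have oO : open O.
  rewrite openE => p [cp xp]; apply: filterI; first exact: cdom_nbhs.
  by apply: (cmap_cvg cp); apply: open_nbhs_nbhs; split => //; exact: ball_open.
have Oc : O `<=` cdom c by move=> p [].
have XO k : coordinate_field_on c O k (X k).
  by move=> p [cp xp]; rewrite /X (test_section_home hM)// scale1r.
have BO x : ball x0 r x -> (cmap c @` O) x.
  move=> xx; have cx : cimg c x by exact: ball_cimg xx.
  by exists (cinv c x); [split; [exact: cinv_cdom|rewrite /= cinv_cimgK]|exact: cinv_cimgK].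
suff : {ae mu, forall x, forall i j, ball x0 r x -> forall k, G k j i x = G k i j x}.
  by apply: ae_imp => x H xx k j i; exact: H.
apply: ae_forall => i; apply: ae_forall => j.
have E1 := christoffelE hG (XL i) (XL j) oO Oc (XO i) (XO j).
have E2 := christoffelE hG (XL j) (XL i) oO Oc (XO j) (XO i).
have E3 := connection_torsion_free hD (XL i) (XL j) Ac.
apply: ae_imp (ae_and E1 (ae_and E2 E3)) => x [e1 [e2 e3]] xx k.
rewrite -e1 -?e2; [|exact: BO..].
apply/eqP; rewrite -subr_eq0 (e3 (ball_cimg r0 rc xx)); apply/eqP.
rewrite /lie_bracket big1// => l _; rewrite !pderiv_test_section//.
have p1 : pderiv l (fun=> 1 : R) x = 0 by exact: derive_cst.
by rewrite p1 !mul0r !mulr0 subrr.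
Qed.

Definition partials_at (V : section R n M) x i j := pderiv i (coord_fun V c j) x.
Definition components_at (V : section R n M) x j := coord_fun V c j x.
Definition christoffel_at x k j i := G k j i x.

Lemma Q_integrandE V W x : Q_integrand G V W c x =
  trace_form (partials_at V x) (partials_at W x) +
  trace_form (partials_at V x) (zeroth_part (christoffel_at x) (components_at W x)) +
  trace_form (zeroth_part (christoffel_at x) (components_at V x)) (partials_at W x) +
  trace_form (zeroth_part (christoffel_at x) (components_at V x))
    (zeroth_part (christoffel_at x) (components_at W x)).
Proof.
rewrite -trace_formD /Q_integrand /trace_form; apply: eq_bigr => i _; apply: eq_bigr => j _.
rewrite /nabla_half_density /zeroth_part /christoffel_trace.
by rewrite /christoffel_at /partials_at /components_at !addrA.
Qed.

Lemma Q_integrand_ae V W : {ae mu, forall x, cimg c x ->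
  Q_integrand G V W c x =
  trace_form (partials_at V x) (partials_at W x) +
  trace_form (partials_at V x) (zeroth_part (christoffel_at x) (components_at W x)) +
  trace_form (partials_at W x) (zeroth_part (christoffel_at x) (components_at V x)) +
  \sum_k \sum_l components_at V x k * components_at W x l *
    ricci_quad (christoffel_at x) k l}.
Proof.
apply: ae_imp christoffel_sym => x Gs cx; rewrite Q_integrandE.
rewrite -[in RHS]trace_form_zeroth_part; last by move=> k j i; exact: Gs.
by rewrite (trace_formC (partials_at W x)).
Qed.

Section lipschitz_components.
Variable V : section R n M.
Hypothesis Vlip : forall j, loc_lipschitz (cimg c) (coord_fun V c j : _ -> R^o).

Lemma coord_lip_at j x : cimg c x -> lip_at (coord_fun V c j : _ -> R^o) x.
Proof. by move=> cx; apply: (loc_lipschitzP _ (@cimg_open _ _ _ c)).1 cx. Qed.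

Let coord_cont j : {in cimg c, continuous (coord_fun V c j : _ -> R^o)}.
Proof.
by move=> x; rewrite inE => cx; apply: lip_at_continuous; exact: coord_lip_at.
Qed.

Lemma loc_bounded_components j : loc_bounded (cimg c) (fun x => components_at V x j).
Proof.
apply: loc_boundedP.
  by apply: measurable_continuous_Rn (@coord_cont j); exact: cimg_open.
by move=> x /(coord_lip_at j) /lip_at_bounded[k _ Hk]; exists k.
Qed.

Lemma loc_bounded_partials i j : loc_bounded (cimg c) (fun x => partials_at V x i j).
Proof.
apply: loc_boundedP; first by apply: measurable_pderiv (@coord_cont j); exact: cimg_open.
by move=> x cx; exact: (pderiv_bounded i (coord_lip_at j cx)).
Qed.

End lipschitz_components.

Let mc := measurable_cimg c.

Section sufficiency.
Hypothesis G_int : forall k j i, loc_integrable (cimg c) (G k j i).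
Hypothesis ricci_int : forall k l,
  loc_integrable (cimg c) (fun x => ricci_quad (christoffel_at x) k l).
Variables V W : section R n M.
Hypothesis Vlip : forall j, loc_lipschitz (cimg c) (coord_fun V c j : _ -> R^o).
Hypothesis Wlip : forall j, loc_lipschitz (cimg c) (coord_fun W c j : _ -> R^o).

Lemma loc_integrable_zeroth_part (X : section R n M) i j :
  (forall j, loc_lipschitz (cimg c) (coord_fun X c j : _ -> R^o)) ->
  loc_integrable (cimg c) (fun x => zeroth_part (christoffel_at x) (components_at X x) i j).
Proof.
move=> Xlip; apply: loc_integrableB => //.
  apply: loc_integrable_sum => // k; under eq_fun do rewrite mulrC.
  apply: loc_integrableM => //; [exact: loc_bounded_components|exact: G_int].
under eq_fun do rewrite mulrC.
apply: loc_integrableM => //; first exact: loc_bounded_components.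
by apply: loc_integrableZ => //; apply: loc_integrable_sum => // k; exact: G_int.
Qed.

Lemma loc_integrable_trace_form (p q : 'rV[R]_n -> 'I_n -> 'I_n -> R) :
  (forall i j, loc_bounded (cimg c) (fun x => p x i j)) ->
  (forall i j, loc_integrable (cimg c) (fun x => q x i j)) ->
  loc_integrable (cimg c) (fun x => trace_form (p x) (q x)).
Proof.
move=> Hp Hq; apply: loc_integrable_sum => // i; apply: loc_integrable_sum => // j.
by apply: loc_integrableB => //; apply: loc_integrableM.
Qed.

Lemma measurable_nabla (X : section R n M) i j :
  (forall j, loc_lipschitz (cimg c) (coord_fun X c j : _ -> R^o)) ->
  measurable_fun (cimg c : set (Rn R n)) (nabla_half_density G X c i j).
Proof.
move=> Xlip; have mG k l m := (christoffel_measurable hG k l m).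
apply: measurable_funB.
  apply: measurable_funD; first exact: (loc_bounded_partials Xlip i j).1.
  apply: measurable_sum => k; apply: measurable_funM; first exact: mG.
  exact: (loc_bounded_components Xlip k).1.
apply: measurable_funM; last exact: (loc_bounded_components Xlip j).1.
apply: measurable_funM; first exact: measurable_cst.
by apply: measurable_sum => k; exact: mG.
Qed.

(** By the splitting of the integrand, whose four terms are bounded, bounded times
    Gamma (twice), and bounded times the quadratic part of the Ricci tensor. *)
Lemma Q_locally_integrable : loc_integrable (cimg c) (Q_integrand G V W c).
Proof.
apply: (loc_integrable_ae mc) (_ : loc_integrable (cimg c) (fun x =>
  trace_form (partials_at V x) (partials_at W x) +
  trace_form (partials_at V x) (zeroth_part (christoffel_at x) (components_at W x)) +
  trace_form (partials_at W x) (zeroth_part (christoffel_at x) (components_at V x)) +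
  \sum_k \sum_l components_at V x k * components_at W x l *
    ricci_quad (christoffel_at x) k l)) _ _.
- apply: loc_integrableD; last first.
    apply: loc_integrable_sum => // k; apply: loc_integrable_sum => // l.
    apply: loc_integrableM => //.
    by apply: loc_boundedM; exact: loc_bounded_components.
  apply: loc_integrableD; last first.
    by apply: loc_integrable_trace_form => i j;
      [exact: loc_bounded_partials|exact: loc_integrable_zeroth_part].
  apply: loc_integrableD; last first.
    by apply: loc_integrable_trace_form => i j;
      [exact: loc_bounded_partials|exact: loc_integrable_zeroth_part].
  apply: loc_integrable_trace_form => i j; first exact: loc_bounded_partials.
  by apply: loc_bounded_integrable => //; exact: loc_bounded_partials.
- apply: measurable_sum => i; apply: measurable_sum => j.
  by apply: measurable_funB; apply: measurable_funM; exact: measurable_nabla.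
- by apply: ae_imp (Q_integrand_ae V W) => x H cx; rewrite H.
Qed.

End sufficiency.

Lemma integrable_compact_support (f : 'rV[R]_n -> R) (L : set 'rV[R]_n) :
  loc_integrable (cimg c) f -> compact L -> L `<=` cimg c ->
  (forall x, cimg c x -> ~ L x -> f x = 0) ->
  mu.-integrable (cimg c : set (Rn R n)) (EFin \o f).
Proof.
move=> [mf If] cL Lc f0; have mL := measurable_compact_Rn cL.
rewrite -(setDUK Lc); apply: integrable_union => //.
- exact: measurableD.
- exact: If.
apply: (eq_integrable _ (cst 0%E)); first exact: measurableD.
  by move=> x; rewrite inE => -[cx Lx] /=; rewrite f0.
by apply: integrable0; exact: measurableD.
Qed.

Section necessity.
Hypothesis hT : tame A D.
Variables (x0 : 'rV[R]_n) (r : R).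
Hypotheses (r0 : 0 < r) (rc : closed_ball x0 (2 * (2 * r)) `<=` cimg c).
Local Notation B := (ball x0 r).

Let rc' : closed_ball x0 (2 * r) `<=` cimg c.
Proof.
apply: subset_trans rc; apply: le_closed_ball.
by rewrite ler_peMl ?ler1n// mulr_ge0// ltW.
Qed.

Let mB : measurable (B : set (Rn R n)).
Proof. by apply: open_measurable_Rn; exact: ball_open. Qed.

Let Bc : B `<=` cimg c. Proof. by move=> x; exact: ball_cimg. Qed.

Local Notation tfield a k := (test_section A c x0 r 2^-1 a k).

(** On the ball where the cutoff is 1, the localized integrand is the integrand itself. *)
Lemma tame_test (a b : 'rV[R]_n -> R) (k l : 'I_n) :
  (forall x, lip_at (a : _ -> R^o) x) -> (forall x, lip_at (b : _ -> R^o) x) ->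
  loc_integrable B (Q_integrand G (tfield a k) (tfield b l) c).
Proof.
move=> la lb.
have I : mu.-integrable (cimg c : set (Rn R n)) (fun x =>
    (cutoff c x0 r (cinv c x) * Q_integrand G (tfield a k) (tfield b l) c x)%:E).
  have cK : compact (cinv c @` closed_ball x0 (2 * r)).
    by apply: compact_cinv rc'; apply: compact_closed_ball_Rn; rewrite mulr_gt0.
  have lF d m : (forall x, lip_at (d : _ -> R^o) x) ->
      lipschitz_half_density A (tfield d m).
    by move=> ?; exact: test_section_lipschitz.
  have vF d m : vanishes_off (cinv c @` closed_ball x0 (2 * r)) (tfield d m).
    exact: test_section_vanishes_off.
  exact: (@hT (tfield a k) (tfield b l) _ (lF a k la) (lF b l lb) cK
    (vF a k) (vF b l) 1%N _ _ (cutoff_partition hM Ac r0 rc) ord0 G hG).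
have {}I := integrableS mc mB Bc I.
have {}I : mu.-integrable (B : set (Rn R n))
    (EFin \o Q_integrand G (tfield a k) (tfield b l) c).
  apply: eq_integrable I => // x; rewrite inE => Bx /=.
  by rewrite (cutoff1 r0 rc Bx) mul1r.
split; first by apply/measurable_EFinP; case/integrableP : I.
move=> K cK KB; apply: integrableS I => //; exact: measurable_compact_Rn.
Qed.

Lemma pderiv_coord i p (x : 'rV[R]_n) :
  pderiv i (fun y : 'rV[R]_n => y ord0 p) x = (i == p)%:R.
Proof.
have dc : differentiable (fun N : 'rV[R]_n => N ord0 p : R^o) x.
  exact: differentiable_coord.
rewrite /pderiv (deriveE _ dc) diff_coord mxE eqxx /=.
by rewrite eq_sym.
Qed.

Lemma lip_at_coord p (x : 'rV[R]_n) : lip_at (fun y : 'rV[R]_n => y ord0 p : R^o) x.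
Proof.
exists 1; near=> q; rewrite mul1r.
by have := mx_entry_norm (q.1 - q.2) ord0 p; rewrite !mxE.
Unshelve. all: by end_near. Qed.

Let lip1 (x : 'rV[R]_n) : lip_at (fun=> 1 : R^o) x.
Proof. exact: lip_at_cst. Qed.

Lemma measurable_ricci k l :
  measurable_fun (cimg c : set (Rn R n)) (fun x => ricci_quad (christoffel_at x) k l).
Proof.
have mG i j m := (christoffel_measurable hG i j m).
apply: measurable_sum => i; apply: measurable_sum => j.
by apply: measurable_funB; apply: measurable_funM; exact: mG.
Qed.

Lemma sum_delta2 (F : 'I_n -> 'I_n -> R) (s t : R) k l :
  \sum_i \sum_j (s * (i == k)%:R) * (t * (j == l)%:R) * F i j = s * t * F k l.
Proof.
rewrite (bigD1 k)//= [X in _ + X]big1 ?addr0; last first.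
  by move=> i /negbTE ->; rewrite big1// => j _; rewrite mulr0 !mul0r.
rewrite (bigD1 l)//= [X in _ + X]big1 ?addr0; last first.
  by move=> j /negbTE ->; rewrite !mulr0 mul0r.
by rewrite !eqxx !mulr1.
Qed.

Lemma components_test a m x : B x ->
  components_at (tfield a m) x = fun j => a x * (j == m)%:R.
Proof. by move=> Bx; apply/funext => j; rewrite /components_at coord_test_section. Qed.

Lemma partials_constant m x : B x -> partials_at (tfield (fun=> 1) m) x = fun _ _ => 0.
Proof.
move=> Bx; apply/funext => i; apply/funext => j; rewrite /partials_at pderiv_test_section//.
by rewrite (_ : pderiv _ _ _ = 0) ?mul0r//; exact: derive_cst.
Qed.

(** For constant components all terms but the last one vanish. *)
Lemma ricci_loc_integrable k l :
  loc_integrable B (fun x => ricci_quad (christoffel_at x) k l).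
Proof.
apply: (loc_integrable_ae mB (tame_test k l lip1 lip1)).
  exact: measurable_funS mc Bc (measurable_ricci k l).
apply: ae_imp (Q_integrand_ae (tfield (fun=> 1) k) (tfield (fun=> 1) l)) => x Hx Bx.
rewrite Hx; last exact: ball_cimg Bx.
rewrite !partials_constant// !components_test// trace_form0.
rewrite [trace_form _ (zeroth_part _ _)]trace_formC trace_form0.
by rewrite [trace_form _ (zeroth_part _ _)]trace_formC trace_form0 sum_delta2 !mul1r !add0r.
Qed.

Lemma measurable_christoffel_trace l :
  measurable_fun (cimg c : set (Rn R n)) (fun x => christoffel_trace (christoffel_at x) l).
Proof. by apply: measurable_sum => k; exact: (christoffel_measurable hG k k l). Qed.

Lemma measurable_mixed p k l :
  measurable_fun (cimg c : set (Rn R n)) (fun x => mixed (christoffel_at x) p k l).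
Proof.
apply: measurable_funB; last exact: (christoffel_measurable hG p l k).
by apply: measurable_funD; apply: measurable_funM => //; apply: measurable_funM => //;
  exact: measurable_christoffel_trace.
Qed.

Lemma loc_bounded_coord p : loc_bounded B (fun x => x ord0 p).
Proof.
apply: loc_boundedP.
  apply: measurable_continuous_Rn => [|x _]; first exact: ball_open.
  by apply: lip_at_continuous; exact: lip_at_coord.
by move=> x _; have [k _ Hk] := lip_at_bounded (lip_at_coord p x); exists k.
Qed.

(** Only two terms of the integrand remain for v = x^p e_k and w = e_l; the one with
    the Ricci tensor is integrable by the previous case, since x^p is bounded. *)
Lemma mixed_loc_integrable p k l :
  loc_integrable B (fun x => mixed (christoffel_at x) p k l).
Proof.
have xricci := loc_integrableM mB (loc_bounded_coord p) (ricci_loc_integrable k l).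
have QI := tame_test k l (lip_at_coord p) lip1.
apply: (loc_integrable_ae mB (loc_integrableB mB QI xricci)).
  exact: measurable_funS mc Bc (measurable_mixed p k l).
apply: ae_imp (ae_and christoffel_sym
  (Q_integrand_ae (tfield (fun y : 'rV[R]_n => y ord0 p) k) (tfield (fun=> 1) l))).
move=> x [Gs Hx] Bx.
have dp : partials_at (tfield (fun y : 'rV[R]_n => y ord0 p) k) x =
    fun i j => (i == p)%:R * (j == k)%:R.
  apply/funext => i; apply/funext => j; rewrite /partials_at pderiv_test_section//.
  by rewrite pderiv_coord.
rewrite Hx; last exact: Bc.
rewrite partials_constant// dp !components_test// sum_delta2 trace_form0 add0r.
rewrite [trace_form (fun _ _ => 0) _]trace_formC trace_form0 addr0 mulr1.
have -> : (fun j : 'I_n => 1 * (j == l)%:R) = (fun j => (j == l)%:R) :> (_ -> R).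
  by apply/funext => j; rewrite mul1r.
by rewrite addrK trace_form_mixed// => m j i; exact: Gs (Bc Bx) m j i.
Qed.

Lemma christoffel_trace_loc_integrable (hn : (1 < n)%N) l :
  loc_integrable B (fun x => christoffel_trace (christoffel_at x) l).
Proof.
have n1 : (n%:R - 1 : R) != 0 by rewrite subr_eq0 pnatr_eq1 gtn_eqF.
have S := loc_integrable_sum (index_enum 'I_n) mB (fun k => mixed_loc_integrable k k l).
apply: (loc_integrable_ae mB (loc_integrableZ (2 / (n%:R - 1)) mB S)).
  exact: measurable_funS mc Bc (measurable_christoffel_trace l).
apply: ae_imp christoffel_sym => x Gs Bx.
rewrite mixed_trace; last by move=> k j i; exact: Gs (Bc Bx) k j i.
by field.
Qed.

(** Solve the formula for the mixed term for Gamma, the traces being known to be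
    integrable. *)
Lemma christoffel_loc_integrable (hn : (1 < n)%N) k j i : loc_integrable B (G k j i).
Proof.
have tr := christoffel_trace_loc_integrable hn.
have := loc_integrableB mB (loc_integrableD
  (loc_integrableZ 2^-1 mB (loc_integrableZ (i == k)%:R mB (tr j)))
  (loc_integrableZ 2^-1 mB (loc_integrableZ (j == k)%:R mB (tr i))))
  (mixed_loc_integrable k i j).
by congr (loc_integrable B _); apply/funext => x; rewrite /mixed opprB addrCA subrr addr0.
Qed.

End necessity.
End christoffel.

Theorem proposition3p6 (R : realType) (n : nat) (hn : (1 < n)%N)
    (M : topologicalType) (A : set (chart R n M)) (hM : C11_manifold A)
    (D : section R n M -> section R n M -> section R n M)
    (hD : measurable_torsion_free_connection A D) :
  tame A D <->
  forall (c : chart R n M) (G : 'I_n -> 'I_n -> 'I_n -> 'rV[R]_n -> R),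
    A c -> is_christoffel A D c G ->
    (forall i j k, locally_integrable_on (cimg c) (G i j k)) /\
    (forall k l, locally_integrable_on (cimg c)
       (fun x => \sum_i \sum_j (G i k l x * G j j i x - G j k i x * G i l j x))).
Proof.
split=> [hT c G Ac hG|H V W K [_ lV] [_ lW] cK vV vW m c chi pou a G hG].
  have local (f : 'rV[R]_n -> R) : measurable_fun (cimg c : set (Rn R n)) f ->
      (forall x0 r, 0 < r -> closed_ball x0 (2 * (2 * r)) `<=` cimg c ->
        locally_integrable_on (ball x0 r) f) ->
      locally_integrable_on (cimg c) f.
    move=> mf Hf; apply: loc_integrable_local mf _ => x /cimg_closed_ball[r r0 rc].
    exists (ball x r); last exact: Hf.
    by split; [exact: ball_open|exact: ballxx].
  split=> [i j k|k l]; apply: local => [|x0 r r0 rc].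
  - exact: (christoffel_measurable hG i j k).
  - exact: (christoffel_loc_integrable hM hD Ac hG hT r0 rc).
  - exact: (measurable_ricci hG k l).
  - exact: (ricci_loc_integrable hM hD Ac hG hT r0 rc).
have Ac := pou_atlas pou a.
have [G_int ricci_int] := H (c a) G Ac hG.
have mc := measurable_cimg (c a).
have [L [cL Lc chi0]] := pou_support pou a.
have bchi : loc_bounded (cimg (c a)) (chi a \o cinv (c a)).
  have cont x : cimg (c a) x -> {for x, continuous (chi a \o cinv (c a) : _ -> R^o)}.
    move=> cx; apply: continuous_comp; first exact: cinv_cvg.
    exact: (pou_continuous pou).
  apply: loc_boundedP => [|x /cont].
    apply: measurable_continuous_Rn; first exact: cimg_open.
    by move=> x; rewrite inE => /cont.
  move=> /cvgrPdist_le/(_ 1 ltr01) cx; exists (`|(chi a \o cinv (c a)) x| + 1).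
  apply: filterS cx => y cy.
  rewrite -[X in `|X| <= _](subKr ((chi a \o cinv (c a)) x)).
  by apply: le_trans (ler_normB _ _) _; rewrite lerD2l.
have Q_int := Q_locally_integrable hM hD Ac hG G_int ricci_int
  (fun j => lV _ j Ac) (fun j => lW _ j Ac).
apply: (integrable_compact_support (loc_integrableM mc bchi Q_int) (L := cmap (c a) @` L)).
- apply: continuous_compact cL; apply: continuous_in_subspaceT => p.
  by rewrite inE => /Lc cp; exact: cmap_cvg.
- by move=> _ [p /Lc cp <-]; exact: cmap_cimg.
- move=> x cx Lx; rewrite /= chi0 ?mul0r// => Lcx; apply: Lx.
  by exists (cinv (c a) x) => //; exact: cinv_cimgK.
Qed.
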